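(* Let $(A,C,\psi)$ be an entwining structure over $k$ and $\mathfrak S$ a $k$-linear Grothendieck category such that $(C,-):\mathfrak S\to\mathfrak S$ is exact. Let ${}^{[C,-]}\mathcal F:{}^{[C,-]}_{A}\mathfrak S(\psi)\to{}^{[C,-]}\mathfrak S$ be the forgetful functor and ${}^{[C,-]}\mathcal T:{}^{[C,-]}\mathfrak S\to{}^{[C,-]}_{A}\mathfrak S(\psi)$, $\mathcal M\mapsto(A,\mathcal M)$, its right adjoint. (a) The space $V:=Nat(id_{{}^{[C,-]}\mathfrak S},{}^{[C,-]}\mathcal F\,{}^{[C,-]}\mathcal T)$ is isomorphic to the space $V_1$ of natural transformations $\sigma:id_{\mathfrak S}\to(A,C,-)$ satisfying $$(A,\Delta,\mathcal M)\circ(\psi,C,\mathcal M)\circ(C,\sigma_{\mathcal M})=(A,\Delta,\mathcal M)\circ\sigma_{(C,\mathcal M)}:(C,\mathcal M)\to(A,C,\mathcal M)$$ for each $\mathcal M\in\mathfrak S$. Moreover, the following are equivalent: (i) The functor ${}^{[C,-]}\mathcal T$ is separable. (ii) There exists $\sigma\in V_1$ such that $(\eta,C,\mathcal M)\circ\sigma_{\mathcal M}=(\epsilon,\mathcal M)$ for each $\mathcal M\in\mathfrak S$. (b) The space $W:=Nat({}^{[C,-]}\mathcal T\,{}^{[C,-]}\mathcal F,id_{{}^{[C,-]}_{A}\mathfrak S(\psi)})$ is isomorphic to the space $W_1$ of natural transformations $\rho:(A,A,-)\to(C,-)$ between endofunctors of $\mathfrak S$ satisfying, for each $\mathcal M\in\mathfrak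 S$, $$(A,\rho_{\mathcal M})\circ(\mu,A,\mathcal M)=(\psi,\mathcal M)\circ\rho_{(A,\mathcal M)}\circ(A,\mu,\mathcal M),$$ $$(\Delta,\mathcal M)\circ(C,\rho_{\mathcal M})=(\Delta,\mathcal M)\circ\rho_{(C,\mathcal M)}\circ(A,\psi,\mathcal M)\circ(\psi,A,\mathcal M).$$ Moreover, the following are equivalent: (i) The functor ${}^{[C,-]}\mathcal F$ is separable. (ii) There exists $\rho\in W_1$ such that $\rho_{\mathcal M}\circ(\mu,\mathcal M)=(\epsilon,\mathcal M)\circ(\eta,\mathcal M)$ for each $\mathcal M\in\mathfrak S$.
   Context: Conventions. $k$ is a field of characteristic zero and $\otimes=\otimes_k$. For $\mathcal M\in\mathfrak S$, $\mathcal M\otimes-:Mod_k\to\mathfrak S$ is the left adjoint of $\mathfrak S(\mathcal M,-):\mathfrak S\to Mod_k$; this gives a bifunctor, and we also write $V\otimes\mathcal M$ for $\mathcal M\otimes V$. For $V\in Mod_k$, $(V,-):\mathfrak S\to\mathfrak S$ is the right adjoint of $V\otimes-$; this is a bifunctor $Mod_k^{op}\times\mathfrak S\to\mathfrak S$ with $(k,\mathcal M)=\mathcal M$ and $(V,(V',\mathcal M))\cong(V'\otimes V,\mathcal M)$. Write $(V_1,\dots,V_n,\mathcal M):=(V_1,(V_2,\dots(V_n,\mathcal M)))=(V_n\otimes\cdots\otimes V_1,\mathcal M)$. A linear map $f:V_m\otimes\cdots\otimes V_1\to W_n\otimes\cdots\otimes W_1$ induces $(f,\mathcal M):(W_1,\dots,W_n,\mathcal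 M)\to(V_1,\dots,V_m,\mathcal M)$; an object written in a slot of a morphism denotes the identity in that slot. $(A,\mu,\eta)$ is a $k$-algebra and $(C,\Delta,\epsilon)$ a $k$-coalgebra. An entwining structure $(A,C,\psi)$ is a linear map $\psi:C\otimes A\to A\otimes C$ with $\psi(C\otimes\mu)=(\mu\otimes C)(A\otimes\psi)(\psi\otimes A)$, $\psi(C\otimes\eta)=\eta\otimes C$, $(A\otimes\Delta)\psi=(\psi\otimes C)(C\otimes\psi)(\Delta\otimes A)$, $(A\otimes\epsilon)\psi=\epsilon\otimes A$. Thus $(\psi,\mathcal M):(C,A,\mathcal M)\to(A,C,\mathcal M)$, $(\Delta,\mathcal M):(C,C,\mathcal M)\to(C,\mathcal M)$, $(\mu,\mathcal M):(A,\mathcal M)\to(A,A,\mathcal M)$, $(\epsilon,\mathcal M):\mathcal M\to(C,\mathcal M)$, $(\eta,\mathcal M):(A,\mathcal M)\to\mathcal M$. A left $A$-module object is $(\mathcal M,\mu_{\mathcal M}:\mathcal M\to(A,\mathcal M))$ with $(\mu,\mathcal M)\mu_{\mathcal M}=(A,\mu_{\mathcal M})\mu_{\mathcal M}$, $(\eta,\mathcal M)\mu_{\mathcal M}=id$. ${}^{[C,-]}\mathfrak S$ is the category of left $C$-contramodule objects $(\mathcal M,\pi_{\mathcal M}:(C,\mathcal M)\to\mathcal M)$ in $\mathfrak S$: $\pi_{\mathcal M}(\epsilon,\mathcal M)=id$, $\pi_{\mathcal M}(\Delta,\mathcal M)=\pi_{\mathcal M}(C,\pi_{\mathcal M})$.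 ${}^{[C,-]}_{A}\mathfrak S(\psi)$ is the category of left entwined contramodule objects: triples $(\mathcal M,\pi_{\mathcal M},\mu_{\mathcal M})$ with both structures such that $\mu_{\mathcal M}\pi_{\mathcal M}=(A,\pi_{\mathcal M})(\psi,\mathcal M)(C,\mu_{\mathcal M})$; morphisms preserve both structures. The functor ${}^{[C,-]}\mathcal T$ sends $(\mathcal M,\pi_{\mathcal M})$ to $(A,\mathcal M)$ with $\mu_{(A,\mathcal M)}=(\mu,\mathcal M)$ and $\pi_{(A,\mathcal M)}=(A,\pi_{\mathcal M})(\psi,\mathcal M)$. A functor $F:\mathcal C\to\mathcal D$ is separable if the natural transformation $\mathcal C(-,-)\to\mathcal D(F-,F-)$ induced by $F$ has a natural left inverse. $Nat$ denotes the space of natural transformations. *)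

(* Defs.v *)
From HB Require Import structures.
From mathcomp Require Import all_boot all_algebra all_classical.

Set Implicit Arguments.
Unset Strict Implicit.
Unset Printing Implicit Defensive.

Import GRing.Theory.
Local Open Scope ring_scope.
Local Open Scope quotient_scope.

Definition mklin (k : fieldType) (U V : lmodType k) (f : U -> V)
    (f_lin : linear f) : {linear U -> V} :=
  HB.pack f (GRing.isLinear.Build k U V *:%R f f_lin).

Section LinearMaps.
Context (k : fieldType) (U V : lmodType k).
Implicit Types f g h : {linear U -> V}.

Lemma lin_ext f g : f =1 g -> f = g.
Proof.
case: f g => [f [[f0] [f1]]] [g [[g0] [g1]]] /= /funext fg; subst g.
by rewrite (Prop_irrelevance f0 g0) (Prop_irrelevance f1 g1).
Qed.

HB.instance Definition _ := gen_eqMixin {linear U -> V}.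
HB.instance Definition _ := gen_choiceMixin {linear U -> V}.

Definition lin_zero : {linear U -> V} := \0.
Definition lin_add f g : {linear U -> V} := f \+ g.
Definition lin_scale (a : k) f : {linear U -> V} := a \*: f.
Definition lin_opp f : {linear U -> V} := lin_scale (-1) f.

Fact lin_addA : associative lin_add.
Proof. by move=> f g h; apply: lin_ext => x /=; rewrite addrA. Qed.
Fact lin_addC : commutative lin_add.
Proof. by move=> f g; apply: lin_ext => x /=; rewrite addrC. Qed.
Fact lin_add0 : left_id lin_zero lin_add.
Proof. by move=> f; apply: lin_ext => x /=; rewrite add0r. Qed.
Fact lin_addN : left_inverse lin_zero lin_opp lin_add.
Proof. by move=> f; apply: lin_ext => x /=; rewrite scaleN1r addNr. Qed.
HB.instance Definition _ := GRing.isZmodule.Build {linear U -> V}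
  lin_addA lin_addC lin_add0 lin_addN.

Fact lin_scaleA a b f : lin_scale a (lin_scale b f) = lin_scale (a * b) f.
Proof. by apply: lin_ext => x /=; rewrite scalerA. Qed.
Fact lin_scale1 : left_id 1 lin_scale.
Proof. by move=> f; apply: lin_ext => x /=; rewrite scale1r. Qed.
Fact lin_scaleDr : right_distributive lin_scale +%R.
Proof. by move=> a f g; apply: lin_ext => x /=; rewrite scalerDr. Qed.
Fact lin_scaleDl f : {morph lin_scale^~ f : a b / a + b}.
Proof. by move=> a b; apply: lin_ext => x /=; rewrite scalerDl. Qed.
HB.instance Definition _ := GRing.Zmodule_isLmodule.Build k {linear U -> V}
  lin_scaleA lin_scale1 lin_scaleDr lin_scaleDl.

End LinearMaps.

Definition bilin (k : fieldType) (U V W : lmodType k) (b : U -> V -> W) : Prop :=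
  (forall v, linear (b^~ v)) /\ (forall u, linear (b u)).

(* U (x) V: finite formal sums of pairs, modulo all the identities that hold
   after applying any bilinear map. *)
Section Tensor.
Context (k : fieldType) (U V : lmodType k).
Implicit Types s t : seq (U * V).

Definition formal_eval (W : lmodType k) (b : U -> V -> W) s : W :=
  \sum_(p <- s) b p.1 p.2.

Definition formal_eq s t : Prop :=
  forall (W : lmodType k) (b : U -> V -> W), bilin b ->
    formal_eval b s = formal_eval b t.

Definition formal_eqb s t : bool := `[< formal_eq s t >].

Fact formal_eqb_refl : reflexive formal_eqb.
Proof. by move=> s; apply/asboolP. Qed.
Fact formal_eqb_sym : symmetric formal_eqb.
Proof.
by move=> s t; apply/asboolP/asboolP => st W b bb; rewrite (st W b bb).
Qed.
Fact formal_eqb_trans : transitive formal_eqb.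
Proof.
move=> t s r /asboolP st /asboolP tr; apply/asboolP => W b bb.
by rewrite (st W b bb) (tr W b bb).
Qed.
Canonical formal_equiv :=
  EquivRel formal_eqb formal_eqb_refl formal_eqb_sym formal_eqb_trans.

Definition tensor := {eq_quot formal_equiv}.
HB.instance Definition _ := Choice.on tensor.
HB.instance Definition _ := EqQuotient.on tensor.

Definition tpi s : tensor := \pi_tensor s.
Definition tscale_seq (a : k) s := [seq (a *: p.1, p.2) | p <- s].

Lemma tpiP s t : formal_eq s t -> tpi s = tpi t.
Proof. by move=> st; apply/eqmodP/asboolP. Qed.

Lemma tpi_eq s t : tpi s = tpi t -> formal_eq s t.
Proof. by move/eqmodP/asboolP. Qed.

Lemma repr_tpi s : formal_eq (repr (tpi s)) s.
Proof. by apply: tpi_eq; rewrite /tpi reprK. Qed.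

Lemma tpi_repr (x : tensor) : tpi (repr x) = x.
Proof. exact: reprK. Qed.

Definition tadd (x y : tensor) : tensor := tpi (repr x ++ repr y).
Definition tscale a (x : tensor) : tensor := tpi (tscale_seq a (repr x)).
Definition topp := tscale (-1).

Lemma formal_eval_cat W b s t :
  @formal_eval W b (s ++ t) = formal_eval b s + formal_eval b t.
Proof. by rewrite /formal_eval big_cat. Qed.

Lemma formal_eval_scale W b a s : bilin b ->
  @formal_eval W b (tscale_seq a s) = a *: formal_eval b s.
Proof.
move=> [bl _]; rewrite /formal_eval big_map scaler_sumr.
by apply: eq_bigr => p _; exact: (linearZ_LR (mklin (bl p.2)) a p.1).
Qed.

Lemma tadd_pi s t : tadd (tpi s) (tpi t) = tpi (s ++ t).
Proof.
apply: tpiP => W b bb; rewrite !formal_eval_cat.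
by rewrite (repr_tpi s bb) (repr_tpi t bb).
Qed.
Lemma tscale_pi a s : tscale a (tpi s) = tpi (tscale_seq a s).
Proof.
by apply: tpiP => W b bb; rewrite !formal_eval_scale // (repr_tpi s bb).
Qed.

Lemma tensor_rep (x : tensor) : {s | x = tpi s}.
Proof. by exists (repr x); rewrite tpi_repr. Qed.

Fact taddA : associative tadd.
Proof.
move=> x y z; have [s ->] := tensor_rep x; have [t ->] := tensor_rep y.
by have [r ->] := tensor_rep z; rewrite !tadd_pi catA.
Qed.
Fact taddC : commutative tadd.
Proof.
move=> x y; have [s ->] := tensor_rep x; have [t ->] := tensor_rep y.
by rewrite !tadd_pi; apply: tpiP => W b _; rewrite !formal_eval_cat addrC.
Qed.
Fact tadd0 : left_id (tpi [::]) tadd.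
Proof. by move=> x; have [s ->] := tensor_rep x; rewrite tadd_pi. Qed.
Fact taddN : left_inverse (tpi [::]) topp tadd.
Proof.
move=> x; have [s ->] := tensor_rep x; rewrite /topp tscale_pi tadd_pi.
apply: tpiP => W b bb; rewrite formal_eval_cat formal_eval_scale //.
by rewrite scaleN1r addNr /formal_eval big_nil.
Qed.
HB.instance Definition _ := GRing.isZmodule.Build tensor taddA taddC tadd0 taddN.

Lemma taddE (x y : tensor) : x + y = tadd x y. Proof. by []. Qed.

Fact tscaleA a b x : tscale a (tscale b x) = tscale (a * b) x.
Proof.
have [s ->] := tensor_rep x; rewrite !tscale_pi.
by apply: tpiP => W c cc; rewrite !formal_eval_scale // scalerA.
Qed.
Fact tscale1 : left_id 1 tscale.
Proof.
move=> x; have [s ->] := tensor_rep x; rewrite tscale_pi.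
by apply: tpiP => W c cc; rewrite formal_eval_scale // scale1r.
Qed.
Fact tscaleDr : right_distributive tscale +%R.
Proof.
move=> a x y; have [s ->] := tensor_rep x; have [t ->] := tensor_rep y.
rewrite !taddE tadd_pi !tscale_pi tadd_pi; apply: tpiP => W c cc.
by rewrite !(formal_eval_cat, formal_eval_scale) // scalerDr.
Qed.
Fact tscaleDl x : {morph tscale^~ x : a b / a + b}.
Proof.
move=> a b /=; have [s ->] := tensor_rep x.
rewrite taddE !tscale_pi !tadd_pi; apply: tpiP => W c cc.
by rewrite !(formal_eval_cat, formal_eval_scale) // scalerDl.
Qed.
HB.instance Definition _ := GRing.Zmodule_isLmodule.Build k tensor
  tscaleA tscale1 tscaleDr tscaleDl.

Lemma tscaleE a (x : tensor) : a *: x = tscale a x. Proof. by []. Qed.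

Definition tmul (u : U) (v : V) : tensor := tpi [:: (u, v)].

Lemma tmul_bilin : bilin tmul.
Proof.
split=> [v a u u' | u a v v']; rewrite /tmul taddE tscaleE tscale_pi tadd_pi; apply: tpiP => W b bb;
  rewrite formal_eval_cat formal_eval_scale // /formal_eval !big_seq1 /=;
  case: bb => bl br; [exact: bl | exact: br].
Qed.

Lemma tpiE s : tpi s = \sum_(p <- s) tmul p.1 p.2.
Proof.
elim: s => [|[u v] s IHs]; first by rewrite big_nil.
by rewrite big_cons -IHs taddE tadd_pi.
Qed.

Lemma tensor_ind (P : tensor -> Prop) :
    P 0 -> (forall x y, P x -> P y -> P (x + y)) ->
    (forall u v, P (tmul u v)) -> forall x, P x.
Proof.
move=> P0 PD Pm x; have [s ->] := tensor_rep x; rewrite tpiE.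
by elim/big_ind: _ => // *; apply: Pm.
Qed.

Section Lift.
Context (W : lmodType k) (b : U -> V -> W) (bb : bilin b).

Definition tlift_fun (x : tensor) : W := formal_eval b (repr x).

Fact tlift_linear : linear tlift_fun.
Proof.
move=> a x y; have [s ->] := tensor_rep x; have [t ->] := tensor_rep y.
rewrite taddE tscaleE tscale_pi tadd_pi /tlift_fun.
rewrite (repr_tpi _ bb) formal_eval_cat formal_eval_scale //.
by rewrite (repr_tpi s bb) (repr_tpi t bb).
Qed.
Definition tlift : {linear tensor -> W} := mklin tlift_linear.

Lemma tliftE u v : tlift (tmul u v) = b u v.
Proof.
by rewrite /tlift /= /tlift_fun (repr_tpi _ bb) /formal_eval big_seq1.
Qed.

End Lift.

Lemma tensor_lin_ext (W : lmodType k) (f g : {linear tensor -> W}) :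
  (forall u v, f (tmul u v) = g (tmul u v)) -> f =1 g.
Proof.
move=> fg; elim/tensor_ind => [|x y IHx IHy|//]; first by rewrite !linear0.
by rewrite !linearD IHx IHy.
Qed.

End Tensor.

Section TensorMaps.
Context (k : fieldType).
Implicit Types U V W : lmodType k.

Definition lin_id V : {linear V -> V} := idfun.

Lemma tmulDl U V (u u' : U) (v : V) : tmul (u + u') v = tmul u v + tmul u' v.
Proof. by have := (tmul_bilin U V).1 v 1 u u'; rewrite /= !scale1r. Qed.
Lemma tmulDr U V (u : U) (v v' : V) : tmul u (v + v') = tmul u v + tmul u v'.
Proof. by have := (tmul_bilin U V).2 u 1 v v'; rewrite !scale1r. Qed.
Lemma tmul0l U V (v : V) : tmul (0 : U) v = 0.
Proof. by apply: (addrI (tmul 0 v)); rewrite -tmulDl !addr0. Qed.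
Lemma tmul0r U V (u : U) : tmul u (0 : V) = 0.
Proof. by apply: (addrI (tmul u 0)); rewrite -tmulDr !addr0. Qed.
Lemma tmulZl U V a (u : U) (v : V) : tmul (a *: u) v = a *: tmul u v.
Proof. by have := (tmul_bilin U V).1 v a u 0; rewrite /= tmul0l !addr0. Qed.
Lemma tmulZr U V a (u : U) (v : V) : tmul u (a *: v) = a *: tmul u v.
Proof. by have := (tmul_bilin U V).2 u a v 0; rewrite tmul0r !addr0. Qed.

Fact tmap_bilin U V U' V' (f : {linear U -> U'}) (g : {linear V -> V'}) :
  bilin (fun u v => tmul (f u) (g v)).
Proof.
by split=> [v a u u' | u a v v']; rewrite linearP ?tmulDl ?tmulDr
  ?tmulZl ?tmulZr.
Qed.
Definition tmap U V U' V' (f : {linear U -> U'}) (g : {linear V -> V'}) :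
  {linear tensor U V -> tensor U' V'} := tlift (tmap_bilin f g).

Lemma tmapE U V U' V' (f : {linear U -> U'}) (g : {linear V -> V'}) u v :
  tmap f g (tmul u v) = tmul (f u) (g v).
Proof. exact: tliftE. Qed.

Fact tassoc_bilin0 U V W (w : W) :
  bilin (fun (u : U) (v : V) => tmul u (tmul v w)).
Proof.
by split=> [v a u u' | u a v v']; rewrite !(tmulDl, tmulDr, tmulZl, tmulZr).
Qed.
Fact tassoc_bilin U V W :
  bilin (fun (t : tensor U V) (w : W) => tlift (tassoc_bilin0 U V w) t).
Proof.
split=> [w a t t' | t a w w']; first by rewrite linearP.
elim/tensor_ind: t => [|x y IHx IHy|u v]; first by rewrite !linear0 addr0.
  by rewrite !linearD IHx IHy addrACA.
by rewrite !tliftE !(tmulDr, tmulZr).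
Qed.
Definition tassoc U V W :
    {linear tensor (tensor U V) W -> tensor U (tensor V W)} :=
  tlift (tassoc_bilin U V W).

Lemma tassocE U V W (u : U) (v : V) (w : W) :
  tassoc U V W (tmul (tmul u v) w) = tmul u (tmul v w).
Proof. by rewrite !tliftE. Qed.

Fact tassocV_bilin0 U V W (u : U) :
  bilin (fun (v : V) (w : W) => tmul (tmul u v) w).
Proof.
by split=> [w a v v' | v a w w']; rewrite !(tmulDl, tmulDr, tmulZl, tmulZr).
Qed.
Fact tassocV_bilin U V W :
  bilin (fun (u : U) (t : tensor V W) => tlift (tassocV_bilin0 V W u) t).
Proof.
split=> [t a u u' | u a t t']; last by rewrite linearP.
elim/tensor_ind: t => [|x y IHx IHy|v w]; first by rewrite !linear0 addr0.
  by rewrite !linearD IHx IHy addrACA.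
by rewrite !tliftE !(tmulDl, tmulZl).
Qed.
Definition tassocV U V W :
    {linear tensor U (tensor V W) -> tensor (tensor U V) W} :=
  tlift (tassocV_bilin U V W).

Lemma tassocVE U V W (u : U) (v : V) (w : W) :
  tassocV U V W (tmul u (tmul v w)) = tmul (tmul u v) w.
Proof. by rewrite !tliftE. Qed.

Lemma tassocVK U V W (t : tensor U (tensor V W)) :
  tassoc U V W (tassocV U V W t) = t.
Proof.
elim/tensor_ind: t => [|x y IHx IHy|u s]; first by rewrite !linear0.
  by rewrite !linearD IHx IHy.
elim/tensor_ind: s => [|x y IHx IHy|v w]; first by rewrite tmul0r !linear0.
  by rewrite tmulDr !linearD IHx IHy.
by rewrite tassocVE tassocE.
Qed.

Fact tunl_bilin V : bilin (fun (a : k^o) (v : V) => a *: v).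
Proof.
split=> [v a b c | b a v v']; first by rewrite scalerDl scalerA.
by rewrite scalerDr !scalerA mulrC.
Qed.
Definition tunl V : {linear tensor k^o V -> V} := tlift (tunl_bilin V).

Lemma tunlE V (a : k) (v : V) : tunl V (tmul (a : k^o) v) = a *: v.
Proof. exact: tliftE. Qed.

Fact tunr_bilin V : bilin (fun (v : V) (a : k^o) => a *: v).
Proof. by case: (tunl_bilin V). Qed.
Definition tunr V : {linear tensor V k^o -> V} := tlift (tunr_bilin V).

Lemma tunrE V (a : k) (v : V) : tunr V (tmul v (a : k^o)) = a *: v.
Proof. exact: tliftE. Qed.

End TensorMaps.
Arguments lin_id {k} V.
Arguments tassoc {k U V W}.
Arguments tassocV {k U V W}.
Arguments tunl {k V}.
Arguments tunr {k V}.

(* The library's lalgType/algType exclude the zero algebra, hence a record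
   given by the structure maps. *)
Record algebra (k : fieldType) := Algebra {
  alg :> lmodType k;
  mu : {linear tensor alg alg -> alg};
  eta : {linear k^o -> alg};
  mu_assoc : forall t : tensor (tensor alg alg) alg,
    mu (tmap mu (lin_id alg) t) = mu (tmap (lin_id alg) mu (tassoc t));
  mu_unitl : forall t : tensor k^o alg, mu (tmap eta (lin_id alg) t) = tunl t;
  mu_unitr : forall t : tensor alg k^o, mu (tmap (lin_id alg) eta t) = tunr t }.

Record coalgebra (k : fieldType) := Coalgebra {
  coalg :> lmodType k;
  Delta : {linear coalg -> tensor coalg coalg};
  eps : {linear coalg -> k^o};
  Delta_coassoc : forall c : coalg,
    tassoc (tmap Delta (lin_id coalg) (Delta c)) =
    tmap (lin_id coalg) Delta (Delta c);
  Delta_counitl : forall c : coalg, tunl (tmap eps (lin_id coalg) (Delta c)) = c;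
  Delta_counitr : forall c : coalg, tunr (tmap (lin_id coalg) eps (Delta c)) = c }.

Record entwining (k : fieldType) (A : algebra k) (C : coalgebra k) := Entwining {
  psi :> {linear tensor C A -> tensor A C};
  psi_mu : forall t : tensor C (tensor A A),
    psi (tmap (lin_id C) (mu A) t) =
    tmap (mu A) (lin_id C) (tassocV (tmap (lin_id A) psi
      (tassoc (tmap psi (lin_id A) (tassocV t)))));
  psi_eta : forall c : C, psi (tmul c (eta A 1)) = tmul (eta A 1) c;
  psi_Delta : forall t : tensor C A,
    tmap (lin_id A) (Delta C) (psi t) =
    tassoc (tmap psi (lin_id C) (tassocV (tmap (lin_id C) psi
      (tassoc (tmap (Delta C) (lin_id A) t)))));
  psi_eps : forall t : tensor C A,
    tunr (tmap (lin_id A) (eps C) (psi t)) = tunl (tmap (eps C) (lin_id A) t) }.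

(* Ob may live in a larger universe than the carriers of the vector spaces,
   so that lincat k has room for the category of all vector spaces. *)
Record lincat (k : fieldType) := LinCat {
  Ob :> Type;
  Mor : Ob -> Ob -> lmodType k;
  idc : forall X : Ob, Mor X X;
  cmp : forall X Y Z : Ob, Mor Y Z -> Mor X Y -> Mor X Z;
  cmp_linr : forall (X Y Z : Ob) (g : Mor Y Z), linear (@cmp X Y Z g);
  cmp_linl : forall (X Y Z : Ob) (f : Mor X Y), linear ((@cmp X Y Z)^~ f);
  cmpA : forall (X Y Z T : Ob) (h : Mor Z T) (g : Mor Y Z) (f : Mor X Y),
    cmp h (cmp g f) = cmp (cmp h g) f;
  cmp1f : forall (X Y : Ob) (f : Mor X Y), cmp (idc Y) f = f;
  cmpf1 : forall (X Y : Ob) (f : Mor X Y), cmp f (idc X) = f }.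
Arguments Mor {k l} X Y.
Arguments idc {k l} X.
Arguments cmp {k l X Y Z} g f.
Arguments cmp_linr {k l} X {Y Z} g.
Arguments cmp_linl {k l X Y} Z f.

Notation "g ∘ f" := (cmp g f) (at level 40, left associativity).

Lemma cmp0f (k : fieldType) (S : lincat k) (X Y Z : S) (f : Mor X Y) :
  (0 : Mor Y Z) ∘ f = 0.
Proof. by have := cmp_linl Z f (-1) 0 0; rewrite /= scaler0 addr0 scaleN1r addNr. Qed.
Lemma cmpf0 (k : fieldType) (S : lincat k) (X Y Z : S) (g : Mor Y Z) :
  g ∘ (0 : Mor X Y) = 0.
Proof. by have := cmp_linr X g (-1) 0 0; rewrite scaler0 addr0 scaleN1r addNr. Qed.

Record functor (k : fieldType) (C D : lincat k) := Functor {
  fobj :> C -> D;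
  fmor : forall X Y : C, Mor X Y -> Mor (fobj X) (fobj Y);
  fmor1 : forall X : C, fmor (idc X) = idc (fobj X);
  fmorM : forall (X Y Z : C) (g : Mor Y Z) (f : Mor X Y),
    fmor (g ∘ f) = fmor g ∘ fmor f }.
Arguments fmor {k C D} F {X Y} f : rename.

Definition idF (k : fieldType) (C : lincat k) : functor C C.
Proof. by exists id (fun X Y => id). Defined.

Definition compF (k : fieldType) (C D E : lincat k)
  (G : functor D E) (F : functor C D) : functor C E.
Proof.
exists (fun X => G (F X)) (fun X Y f => fmor G (fmor F f)) => [X|X Y Z g f].
  by rewrite !fmor1.
by rewrite !fmorM.
Defined.

Notation "G \F F" := (compF G F) (at level 40, left associativity).

Record nat_trans (k : fieldType) (C D : lincat k) (F G : functor C D) :=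
  NatTrans {
    ntc :> forall X : C, Mor (F X) (G X);
    ntP : forall (X Y : C) (f : Mor X Y), fmor G f ∘ ntc X = ntc Y ∘ fmor F f }.

Section NatSpace.
Context (k : fieldType) (C D : lincat k) (F G : functor C D).

Lemma nat_ext (s t : nat_trans F G) : (forall X, s X = t X) -> s = t.
Proof.
case: s t => [s sP] [t tP] /= st.
have {st} e : s = t by apply: functional_extensionality_dep.
by subst t; rewrite (Prop_irrelevance sP tP).
Qed.

Definition nat_lin (a : k) (s t : nat_trans F G) : nat_trans F G.
Proof.
exists (fun X => a *: s X + t X) => X Y f.
by rewrite (cmp_linr _ (fmor G f)) !ntP -(cmp_linl (G Y) (fmor F f) a (s Y) (t Y)).
Defined.

End NatSpace.

(* The space Nat(F, G) is isomorphic to the subspace of Nat(F', G') cut out by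
   P: a k-linear injection with image exactly P. *)
Definition nat_iso_sub (k : fieldType) (C D C' D' : lincat k)
    (F G : functor C D) (F' G' : functor C' D') (P : nat_trans F' G' -> Prop) :=
  exists phi : nat_trans F G -> nat_trans F' G',
    [/\ forall a s t, phi (nat_lin a s t) = nat_lin a (phi s) (phi t),
        injective phi
      & forall s, P s <-> exists t, phi t = s].

Definition separable_functor (k : fieldType) (C D : lincat k) (F : functor C D) :=
  exists P : forall X Y : C, Mor (F X) (F Y) -> Mor X Y,
    (forall (X Y X' Y' : C) (u : Mor X' X) (v : Mor Y Y') (h : Mor (F X) (F Y)),
        P X' Y' (fmor F v ∘ h ∘ fmor F u) = v ∘ P X Y h ∘ u) /\
    (forall (X Y : C) (f : Mor X Y), P X Y (fmor F f) = f).

(* Index sets of coproducts and direct limits live in the universe of the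
   carriers of the k-vector spaces, not in the one of the objects. *)
Definition small_type := Type@{GRing.Lmodule.axioms_.u0}.

Section Grothendieck.
Context (k : fieldType) (S : lincat k).
Implicit Types X Y Z : S.

Definition mono X Y (f : Mor X Y) :=
  forall Z (g h : Mor Z X), f ∘ g = f ∘ h -> g = h.
Definition epi X Y (f : Mor X Y) :=
  forall Z (g h : Mor Y Z), g ∘ f = h ∘ f -> g = h.
Definition is_kernel K X Y (i : Mor K X) (f : Mor X Y) :=
  f ∘ i = 0 /\
  forall Z (g : Mor Z X), f ∘ g = 0 -> exists! h : Mor Z K, i ∘ h = g.
Definition is_cokernel X Y Q (p : Mor Y Q) (f : Mor X Y) :=
  p ∘ f = 0 /\
  forall Z (g : Mor Y Z), g ∘ f = 0 -> exists! h : Mor Q Z, h ∘ p = g.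
Definition is_zero Z :=
  (forall X (f : Mor X Z), f = 0) /\ (forall X (f : Mor Z X), f = 0).
Definition is_biproduct X Y P
    (i : Mor X P) (j : Mor Y P) (p : Mor P X) (q : Mor P Y) :=
  [/\ p ∘ i = idc X, q ∘ j = idc Y, p ∘ j = 0, q ∘ i = 0
    & i ∘ p + j ∘ q = idc P].

Definition is_abelian :=
  (exists Z, is_zero Z) /\
  (forall X Y, exists P (i : Mor X P) (j : Mor Y P) (p : Mor P X) (q : Mor P Y),
      is_biproduct i j p q) /\
  (forall X Y (f : Mor X Y), exists K (i : Mor K X), is_kernel i f) /\
  (forall X Y (f : Mor X Y), exists Q (p : Mor Y Q), is_cokernel p f) /\
  (forall X Y (f : Mor X Y), mono f -> exists Z (g : Mor Y Z), is_kernel f g) /\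
  (forall X Y (f : Mor X Y), epi f -> exists Z (g : Mor Z X), is_cokernel f g).

(* 0 -> X -> Y -> Z -> 0 *)
Definition short_exact X Y Z (f : Mor X Y) (g : Mor Y Z) :=
  is_kernel f g /\ is_cokernel g f.

Definition is_coproduct (I : small_type) (X : I -> S) L (i : forall j, Mor (X j) L) :=
  forall Z (f : forall j, Mor (X j) Z),
    exists! h : Mor L Z, forall j, h ∘ i j = f j.

Definition directed (I : small_type) (le : I -> I -> Prop) :=
  [/\ inhabited I, forall i, le i i,
      forall i j l, le i j -> le j l -> le i l
    & forall i j, exists l, le i l /\ le j l].

Record dsystem (I : small_type) (le : I -> I -> Prop) := DSystem {
  ds :> I -> S;
  dmap : forall i j, le i j -> Mor (ds i) (ds j);
  dmap1 : forall i (h : le i i), dmap h = idc (ds i);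
  dmapM : forall i j l (h : le i j) (h' : le j l) (h'' : le i l),
    dmap h'' = dmap h' ∘ dmap h }.

Section DirectLimits.
Context (I : small_type) (le : I -> I -> Prop).

Definition dsystem_map (X Y : dsystem le) (a : forall i, Mor (X i) (Y i)) :=
  forall i j (h : le i j), dmap Y h ∘ a i = a j ∘ dmap X h.

Definition cocone (X : dsystem le) (L : S) (c : forall i, Mor (X i) L) :=
  forall i j (h : le i j), c j ∘ dmap X h = c i.

Definition is_dlimit (X : dsystem le) (L : S) (c : forall i, Mor (X i) L) :=
  cocone c /\
  forall (L' : S) (c' : forall i, Mor (X i) L'), cocone c' ->
    exists! h : Mor L L', forall i, h ∘ c i = c' i.

End DirectLimits.

Definition direct_limits_exact :=
  forall (I : small_type) (le : I -> I -> Prop), directed le ->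
  forall (X Y Z : dsystem le)
    (a : forall i, Mor (X i) (Y i)) (b : forall i, Mor (Y i) (Z i)),
  dsystem_map a -> dsystem_map b -> (forall i, short_exact (a i) (b i)) ->
  forall (LX LY LZ : S) (cX : forall i, Mor (X i) LX) (cY : forall i, Mor (Y i) LY)
    (cZ : forall i, Mor (Z i) LZ),
  is_dlimit cX -> is_dlimit cY -> is_dlimit cZ ->
  forall (f : Mor LX LY) (g : Mor LY LZ),
  (forall i, f ∘ cX i = cY i ∘ a i) -> (forall i, g ∘ cY i = cZ i ∘ b i) ->
  short_exact f g.

Definition is_generator G :=
  forall X Y (f g : Mor X Y), (forall h : Mor G X, f ∘ h = g ∘ h) -> f = g.

(* Cocompleteness is stated through coproducts: cokernels exist already. *)
Definition grothendieck :=
  [/\ is_abelian,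
      forall (I : small_type) (X : I -> S), exists L (i : forall j, Mor (X j) L),
        is_coproduct i,
      direct_limits_exact
    & exists G, is_generator G].

End Grothendieck.

Definition exact_functor (k : fieldType) (C D : lincat k) (F : functor C D) :=
  forall (X Y Z : C) (f : Mor X Y) (g : Mor Y Z),
    short_exact f g -> short_exact (fmor F f) (fmor F g).

Definition vect (k : fieldType) : lincat k.
Proof.
refine (@LinCat k (lmodType k) (fun U V => {linear U -> V} : lmodType k)
  (fun U => lin_id U) (fun U V W g f => (g \o f : {linear U -> W}))
  _ _ _ _ _) => *; try (move=> a f f'); apply: lin_ext => x //=.
by rewrite linearP.
Defined.

Definition hom_functor (k : fieldType) (S : lincat k) (M : S) :
  functor S (vect k).
Proof.
refine (@Functor k S (vect k) (fun N => Mor M N)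
  (fun X Y f => mklin (cmp_linr M f)) _ _) => [X|X Y Z g f];
  apply: lin_ext => h /=.
- exact: cmp1f.
- by rewrite -[LHS]/((g ∘ f) ∘ h) -cmpA.
Defined.

Record adjunction (k : fieldType) (C D : lincat k)
    (L : functor C D) (R : functor D C) := Adjunction {
  adj_unit : nat_trans (idF C) (R \F L);
  adj_counit : nat_trans (L \F R) (idF D);
  adj_L : forall X : C, adj_counit (L X) ∘ fmor L (adj_unit X) = idc (L X);
  adj_R : forall Y : D, fmor R (adj_counit Y) ∘ adj_unit (R Y) = idc (R Y) }.

Lemma adj_ext (k : fieldType) (C D : lincat k) (L : functor C D)
    (R : functor D C) (a : adjunction L R) (X : C) (Y : D) (f g : Mor (L X) Y) :
  fmor R f ∘ adj_unit a X = fmor R g ∘ adj_unit a X -> f = g.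
Proof.
have E (h : Mor (L X) Y) :
    h = adj_counit a Y ∘ fmor L (fmor R h ∘ adj_unit a X).
  rewrite fmorM cmpA -[fmor L (fmor R h)]/(fmor (L \F R) h).
  by rewrite -(ntP (adj_counit a)) -cmpA adj_L cmpf1.
by move=> fg; rewrite (E f) (E g) fg.
Qed.

Lemma adj_ext' (k : fieldType) (C D : lincat k) (L : functor C D)
    (R : functor D C) (a : adjunction L R) (X : C) (Y : D) (f g : Mor X (R Y)) :
  adj_counit a Y ∘ fmor L f = adj_counit a Y ∘ fmor L g -> f = g.
Proof.
have E (h : Mor X (R Y)) :
    h = fmor R (adj_counit a Y ∘ fmor L h) ∘ adj_unit a X.
  rewrite fmorM -cmpA -[fmor R (fmor L h)]/(fmor (R \F L) h).
  by rewrite (ntP (adj_unit a)) cmpA adj_R cmp1f.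
by move=> fg; rewrite (E f) (E g) fg.
Qed.

(* tens M is the functor M (x) - *)
Record tensoring (k : fieldType) (S : lincat k) := Tensoring {
  tens : forall M : S, functor (vect k) S;
  tens_adj : forall M : S, adjunction (tens M) (hom_functor M) }.

Section Tensoring.
Context (k : fieldType) (S : lincat k) (T : tensoring S).
Implicit Types (M N : S) (V W : lmodType k).

Definition tens_unit M V : {linear V -> Mor M (tens T M V)} :=
  adj_unit (tens_adj T M) V.

Definition tens_lift M V N (f : {linear V -> Mor M N}) : Mor (tens T M V) N :=
  adj_counit (tens_adj T M) N ∘ fmor (tens T M) (f : @Mor _ (vect k) V (Mor M N)).

Lemma tens_liftE M V N (f : {linear V -> Mor M N}) v :
  tens_lift f ∘ tens_unit M V v = f v.
Proof.
have := @ntP _ _ _ _ _ (adj_unit (tens_adj T M)) V (Mor M N) f.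
move/(congr1 (fun h : {linear _ -> _} => h v)) => /= E.
have := adj_R (tens_adj T M) N.
move/(congr1 (fun h : {linear _ -> _} => h (f v))) => /= E'.
rewrite /tens_lift -cmpA -[RHS]E' /=; congr (_ ∘ _); exact: E.
Qed.

Lemma tens_ext M V N (f g : Mor (tens T M V) N) :
  (forall v, f ∘ tens_unit M V v = g ∘ tens_unit M V v) -> f = g.
Proof.
by move=> fg; apply: (@adj_ext _ _ _ _ _ (tens_adj T M)); apply: lin_ext => v;
  exact: fg.
Qed.

Lemma tens_unit_map M V W (f : {linear V -> W}) v :
  fmor (tens T M) (f : @Mor _ (vect k) V W) ∘ tens_unit M V v
    = tens_unit M W (f v).
Proof.
have := @ntP _ _ _ _ _ (adj_unit (tens_adj T M)) V W f.
by move/(congr1 (fun h : {linear _ -> _} => h v)).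
Qed.

Fact tens_mapl_lin M N V (f : Mor M N) :
  linear (fun v : V => tens_unit N V v ∘ f).
Proof. by move=> a u v; rewrite linearP; exact: cmp_linl. Qed.

Arguments tens_mapl_lin {M N} V f.

Definition tens_mapl M N V (f : Mor M N) : Mor (tens T M V) (tens T N V) :=
  tens_lift (mklin (tens_mapl_lin V f)).

Arguments tens_mapl {M N} V f.

Lemma tens_maplE M N V (f : Mor M N) v :
  tens_mapl V f ∘ tens_unit M V v = tens_unit N V v ∘ f.
Proof. by rewrite tens_liftE. Qed.

(* the functor V (x) - *)
Definition tensor_with V : functor S S.
Proof.
exists (fun M => tens T M V) (fun M N f => tens_mapl V f) => [M|M N P g f];
  apply: tens_ext => v; rewrite tens_maplE.
  by rewrite cmpf1 cmp1f.
by rewrite -(cmpA (tens_mapl V g)) (tens_maplE f) !cmpA tens_maplE.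
Defined.

End Tensoring.

(* H V is the functor (V, -). Both adjoints are given data: a tensoring and a
   powering are an arbitrary choice of them. *)
Record powering (k : fieldType) (S : lincat k) (T : tensoring S) := Powering {
  pow :> forall V : lmodType k, functor S S;
  pow_adj : forall V : lmodType k, adjunction (tensor_with T V) (pow V) }.

Section Powering.
Context (k : fieldType) (S : lincat k) (T : tensoring S) (H : powering T).
Implicit Types (M N : S) (U V W : lmodType k).

Definition pow_lift V N M (g : Mor (tensor_with T V N) M) : Mor N (H V M) :=
  fmor (H V) g ∘ adj_unit (pow_adj H V) N.

(* (f, M), the mate of f (x) - *)
Definition pow_map V W (f : {linear V -> W}) M : Mor (H W M) (H V M) :=
  pow_lift (adj_counit (pow_adj H W) M ∘
            fmor (tens T (H W M)) (f : @Mor _ (vect k) V W)).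

(* evaluation at v; the family over v in V is jointly monic (pow_ext), so the
   morphisms into (V, M) are computed through it *)
Definition pow_ev V M (v : V) : Mor (H V M) M :=
  adj_counit (pow_adj H V) M ∘ tens_unit T (H V M) V v.

Fact pow_ev_lin V M : linear (@pow_ev V M).
Proof. by move=> a u v; rewrite /pow_ev linearP; exact: cmp_linr. Qed.

Lemma pow_ev_lift V N M (g : Mor (tensor_with T V N) M) v :
  pow_ev M v ∘ pow_lift g = g ∘ tens_unit T N V v.
Proof.
rewrite /pow_ev -cmpA -tens_maplE cmpA; congr (_ ∘ _).
rewrite -[tens_mapl _ _ _]/(fmor (tensor_with T V) (pow_lift g)) /pow_lift fmorM cmpA.
rewrite -[fmor _ (fmor _ g)]/(fmor (tensor_with T V \F H V) g).
rewrite -(ntP (adj_counit (pow_adj H V))) -cmpA -[RHS]cmpf1.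
congr (_ ∘ _); exact: (adj_L (pow_adj H V) N).
Qed.

Lemma pow_ext V N M (f g : Mor N (H V M)) :
  (forall v, pow_ev M v ∘ f = pow_ev M v ∘ g) -> f = g.
Proof.
move=> fg; apply: (@adj_ext' _ _ _ _ _ (pow_adj H V)); apply: tens_ext => v.
rewrite -[fmor _ f]/(tens_mapl T V f) -[fmor _ g]/(tens_mapl T V g).
by rewrite -!(cmpA (adj_counit (pow_adj H V) M)) !tens_maplE !cmpA; exact: fg.
Qed.

Definition pow_curry V N M (f : {linear V -> Mor N M}) : Mor N (H V M) :=
  pow_lift (tens_lift T f).

Lemma pow_curryE V N M (f : {linear V -> Mor N M}) v :
  pow_ev M v ∘ pow_curry f = f v.
Proof. by rewrite pow_ev_lift tens_liftE. Qed.

Lemma pow_ev_nat V N M (f : Mor N M) v :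
  pow_ev M v ∘ fmor (H V) f = f ∘ pow_ev N v.
Proof.
rewrite /pow_ev -cmpA -tens_maplE [LHS]cmpA [RHS]cmpA; congr (_ ∘ _).
exact: (esym (ntP (adj_counit (pow_adj H V)) f)).
Qed.

Lemma pow_ev_map V W (f : {linear V -> W}) M v :
  pow_ev M v ∘ pow_map f M = pow_ev M (f v).
Proof. by rewrite pow_ev_lift -cmpA tens_unit_map. Qed.

Fact scale_idc_lin M : linear (fun a : k^o => a *: idc M).
Proof. by move=> a b c; rewrite scalerDl scalerA. Qed.

(* (k, M) = M *)
Definition pow_k M : Mor (H k^o M) M := pow_ev M (1 : k^o).
Definition pow_kV M : Mor M (H k^o M) := pow_curry (mklin (@scale_idc_lin M)).

Lemma pow_kK M : pow_k M ∘ pow_kV M = idc M.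
Proof. by rewrite pow_curryE -[LHS]/(1 *: idc M) scale1r. Qed.
Lemma pow_kVK M : pow_kV M ∘ pow_k M = idc (H k^o M).
Proof.
apply: pow_ext => a; rewrite cmpf1 cmpA pow_curryE.
rewrite -[mklin _ a]/((a : k) *: idc M) /pow_k.
rewrite -[LHS]/((mklin (cmp_linl M (pow_ev M (1 : k^o)))) ((a : k) *: idc M)).
rewrite linearZ_LR -[mklin _ _]/(idc M ∘ pow_ev M (1 : k^o)) cmp1f.
rewrite -[pow_ev M a]/(mklin (@pow_ev_lin k^o M) a) -[a in RHS]mulr1.
by rewrite -[_ * _]/(a *: (1 : k^o)) linearZ_LR.
Qed.

Fact pow_ev2_bilin U V M :
  bilin (fun (u : U) (v : V) => pow_ev M u ∘ pow_ev (H U M) v).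
Proof.
split=> [v a u u' | u a v v'].
  by rewrite pow_ev_lin; exact: cmp_linl.
by rewrite pow_ev_lin; exact: cmp_linr.
Qed.
Definition pow_ev2 U V M : {linear tensor U V -> Mor (H V (H U M)) M} :=
  tlift (pow_ev2_bilin U V M).

Fact pow_uncomp_lin0 U V M (v : V) :
  linear (fun u : U => pow_ev M (tmul u v : tensor U V)).
Proof. by move=> a u u'; rewrite tmulDl tmulZl pow_ev_lin. Qed.
Fact pow_uncomp_lin U V M :
  linear (fun v : V => pow_curry (mklin (pow_uncomp_lin0 (U := U) M v))).
Proof.
move=> a v v'; apply: pow_ext => u; rewrite cmp_linr !pow_curryE.
by rewrite -[LHS]/(pow_ev M (tmul u (a *: v + v'))) tmulDr tmulZr pow_ev_lin.
Qed.

(* (V, (U, M)) = (U (x) V, M) *)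
Definition pow_comp U V M : Mor (H V (H U M)) (H (tensor U V) M) :=
  pow_curry (pow_ev2 U V M).
Definition pow_compV U V M : Mor (H (tensor U V) M) (H V (H U M)) :=
  pow_curry (mklin (@pow_uncomp_lin U V M)).

Lemma pow_ev_comp U V M t : pow_ev M t ∘ pow_comp U V M = pow_ev2 U V M t.
Proof. exact: pow_curryE. Qed.

Lemma pow_ev2_tmul U V M u v :
  pow_ev2 U V M (tmul u v) = pow_ev M u ∘ pow_ev (H U M) v.
Proof. by rewrite tliftE. Qed.

Lemma pow_ext2 U V N M (f g : Mor N (H V (H U M))) :
  (forall t, pow_ev2 U V M t ∘ f = pow_ev2 U V M t ∘ g) -> f = g.
Proof.
move=> fg; apply: pow_ext => v; apply: pow_ext => u.
by have := fg (tmul u v); rewrite pow_ev2_tmul -(cmpA _ _ f) -(cmpA _ _ g).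
Qed.

Lemma pow_ev2_compV U V M t : pow_ev2 U V M t ∘ pow_compV U V M = pow_ev M t.
Proof.
rewrite -[LHS]/(mklin (cmp_linl M (pow_compV U V M)) (pow_ev2 U V M t)).
rewrite -[RHS]/(mklin (@pow_ev_lin _ M) t).
rewrite -[LHS]/((mklin (cmp_linl M (pow_compV U V M)) \o pow_ev2 U V M) t).
apply: tensor_lin_ext => u v.
rewrite -[LHS]/(pow_ev2 U V M (tmul u v) ∘ pow_compV U V M) pow_ev2_tmul.
by rewrite -cmpA pow_curryE pow_curryE.
Qed.

Lemma pow_compK U V M : pow_compV U V M ∘ pow_comp U V M = idc _.
Proof.
by apply: pow_ext2 => t; rewrite cmpA pow_ev2_compV pow_ev_comp cmpf1.
Qed.
Lemma pow_compVK U V M : pow_comp U V M ∘ pow_compV U V M = idc _.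
Proof.
by apply: pow_ext => t; rewrite cmpA pow_ev_comp pow_ev2_compV cmpf1.
Qed.

End Powering.

Section CompositionLinear.
Context (k : fieldType) (S : lincat k) (X Y Z : S).

Lemma cmpDl (g g' : Mor Y Z) (f : Mor X Y) : (g + g') ∘ f = g ∘ f + g' ∘ f.
Proof. by have := cmp_linl Z f 1 g g'; rewrite /= !scale1r. Qed.
Lemma cmpDr (g : Mor Y Z) (f f' : Mor X Y) : g ∘ (f + f') = g ∘ f + g ∘ f'.
Proof. by have := cmp_linr X g 1 f f'; rewrite !scale1r. Qed.
Lemma cmpZl a (g : Mor Y Z) (f : Mor X Y) : (a *: g) ∘ f = a *: (g ∘ f).
Proof. by have := cmp_linl Z f a g 0; rewrite /= cmp0f !addr0. Qed.
Lemma cmpZr a (g : Mor Y Z) (f : Mor X Y) : g ∘ (a *: f) = a *: (g ∘ f).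
Proof. by have := cmp_linr X g a f 0; rewrite cmpf0 !addr0. Qed.

End CompositionLinear.

Section PoweringLinear.
Context (k : fieldType) (S : lincat k) (T : tensoring S) (H : powering T).
Implicit Types (M N : S) (U V W : lmodType k).

Lemma pow_ev0 V M : pow_ev H M (0 : V) = 0.
Proof.
have := @pow_ev_lin k S T H V M (-1) 0 0.
by rewrite scaler0 addr0 scaleN1r addNr.
Qed.
Lemma pow_evZ V M a (v : V) : pow_ev H M (a *: v) = a *: pow_ev H M v.
Proof. by have := @pow_ev_lin k S T H V M a v 0; rewrite pow_ev0 !addr0. Qed.
Lemma pow_evD V M (v w : V) : pow_ev H M (v + w) = pow_ev H M v + pow_ev H M w.
Proof. by have := @pow_ev_lin k S T H V M 1 v w; rewrite !scale1r. Qed.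

Lemma fmor_pow_linear V M N : linear (@fmor k S S (H V) M N).
Proof.
move=> a f g; apply: pow_ext => v.
by rewrite cmpDr cmpZr !pow_ev_nat cmpDl cmpZl.
Qed.

Lemma pow_ev2_nat U V N M (f : Mor N M) t :
  pow_ev2 H U V M t ∘ fmor (H V) (fmor (H U) f) = f ∘ pow_ev2 H U V N t.
Proof.
elim/tensor_ind: t => [|x y IHx IHy|u v].
- by rewrite !linear0 cmp0f cmpf0.
- by rewrite !linearD cmpDl cmpDr IHx IHy.
by rewrite !pow_ev2_tmul -cmpA pow_ev_nat cmpA pow_ev_nat cmpA.
Qed.

Fact pow_ev3_bilin U V W M : bilin (fun (u : U) (s : tensor V W) =>
  pow_ev H M u ∘ pow_ev2 H V W (H U M) s).
Proof.
split=> [s a u u' | u a s s']; first by rewrite pow_ev_lin; exact: cmp_linl.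
by rewrite linearP; exact: cmp_linr.
Qed.
Definition pow_ev3 U V W M :
    {linear tensor U (tensor V W) -> Mor (H W (H V (H U M))) M} :=
  tlift (pow_ev3_bilin U V W M).

Fact pow_ev3l_bilin U V W M : bilin (fun (s : tensor U V) (w : W) =>
  pow_ev2 H U V M s ∘ pow_ev H (H V (H U M)) w).
Proof.
split=> [s a u u' | u a s s']; first by rewrite linearP; exact: cmp_linl.
by rewrite pow_ev_lin; exact: cmp_linr.
Qed.
Definition pow_ev3l U V W M :
    {linear tensor (tensor U V) W -> Mor (H W (H V (H U M))) M} :=
  tlift (pow_ev3l_bilin U V W M).

Lemma pow_ev3E U V W M u s :
  pow_ev3 U V W M (tmul u s) = pow_ev H M u ∘ pow_ev2 H V W (H U M) s.
Proof. by rewrite tliftE. Qed.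
Lemma pow_ev3lE U V W M s w :
  pow_ev3l U V W M (tmul s w) = pow_ev2 H U V M s ∘ pow_ev H (H V (H U M)) w.
Proof. by rewrite tliftE. Qed.

Lemma pow_ev3_assoc U V W M t :
  pow_ev3 U V W M (tassoc t) = pow_ev3l U V W M t.
Proof.
elim/tensor_ind: t => [|x y IHx IHy|s w]; first by rewrite !linear0.
  by rewrite !linearD IHx IHy.
rewrite tliftE pow_ev3lE; elim/tensor_ind: s => [|x y IHx IHy|u v].
- by rewrite !linear0 cmp0f.
- by rewrite !linearD IHx IHy cmpDl.
by rewrite tliftE pow_ev3E !pow_ev2_tmul cmpA.
Qed.

Lemma pow_ev3_assocV U V W M t :
  pow_ev3l U V W M (tassocV t) = pow_ev3 U V W M t.
Proof.
elim/tensor_ind: t => [|x y IHx IHy|u s]; first by rewrite !linear0.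
  by rewrite !linearD IHx IHy.
rewrite tliftE pow_ev3E; elim/tensor_ind: s => [|x y IHx IHy|v w].
- by rewrite !linear0 cmpf0.
- by rewrite !linearD IHx IHy cmpDr.
by rewrite tliftE pow_ev3lE !pow_ev2_tmul cmpA.
Qed.

Lemma pow_ext3 U V W N M (f g : Mor N (H W (H V (H U M)))) :
  (forall t, pow_ev3 U V W M t ∘ f = pow_ev3 U V W M t ∘ g) -> f = g.
Proof.
move=> fg; apply: pow_ext2 => s; apply: pow_ext => u.
by have := fg (tmul u s); rewrite pow_ev3E -(cmpA _ _ f) -(cmpA _ _ g).
Qed.

End PoweringLinear.

Section StructureMaps.
Context (k : fieldType) (S : lincat k) (T : tensoring S) (H : powering T).
Context (A : algebra k) (C : coalgebra k) (p : entwining A C).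
Implicit Types M N : S.

(* (mu, M), (eta, M), (Delta, M), (eps, M) and (psi, M), with the
   identifications (k, M) = M and (V, (U, M)) = (U (x) V, M) made explicit *)
Definition pow_mu M : Mor (H A M) (H A (H A M)) :=
  pow_compV H A A M ∘ pow_map H (mu A) M.
Definition pow_eta M : Mor (H A M) M := pow_k H M ∘ pow_map H (eta A) M.
Definition pow_Delta M : Mor (H C (H C M)) (H C M) :=
  pow_map H (Delta C) M ∘ pow_comp H C C M.
Definition pow_eps M : Mor M (H C M) := pow_map H (eps C) M ∘ pow_kV H M.
Definition pow_psi M : Mor (H C (H A M)) (H A (H C M)) :=
  pow_compV H C A M ∘ pow_map H p M ∘ pow_comp H A C M.

Lemma pow_mu_ev M t : pow_ev2 H A A M t ∘ pow_mu M = pow_ev H M (mu A t).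
Proof. by rewrite /pow_mu cmpA pow_ev2_compV pow_ev_map. Qed.
Lemma pow_eta_ev M : pow_eta M = pow_ev H M (eta A 1).
Proof. exact: pow_ev_map. Qed.
Lemma pow_Delta_ev M c :
  pow_ev H M c ∘ pow_Delta M = pow_ev2 H C C M (Delta C c).
Proof. by rewrite /pow_Delta cmpA pow_ev_map pow_ev_comp. Qed.
Lemma pow_eps_ev M c : pow_ev H M c ∘ pow_eps M = (eps C c : k) *: idc M.
Proof. by rewrite /pow_eps cmpA pow_ev_map pow_curryE. Qed.
Lemma pow_psi_ev M t :
  pow_ev2 H C A M t ∘ pow_psi M = pow_ev2 H A C M (p t).
Proof.
rewrite /pow_psi -[_ ∘ pow_comp _ _ _ _]cmpA cmpA pow_ev2_compV.
by rewrite cmpA pow_ev_map pow_ev_comp.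
Qed.

Lemma pow_mu_nat N M (f : Mor N M) :
  fmor (H A) (fmor (H A) f) ∘ pow_mu N = pow_mu M ∘ fmor (H A) f.
Proof.
apply: pow_ext2 => t; rewrite [LHS]cmpA pow_ev2_nat -cmpA pow_mu_ev.
by rewrite [RHS]cmpA pow_mu_ev pow_ev_nat.
Qed.

Lemma pow_psi_nat N M (f : Mor N M) :
  fmor (H A) (fmor (H C) f) ∘ pow_psi N = pow_psi M ∘ fmor (H C) (fmor (H A) f).
Proof.
apply: pow_ext2 => t; rewrite [LHS]cmpA pow_ev2_nat -cmpA pow_psi_ev.
by rewrite [RHS]cmpA pow_psi_ev pow_ev2_nat.
Qed.

Lemma pow_mu_assoc M :
  pow_mu (H A M) ∘ pow_mu M = fmor (H A) (pow_mu M) ∘ pow_mu M.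
Proof.
have L t : pow_ev3l H A A A M t ∘ fmor (H A) (pow_mu M) =
    pow_ev2 H A A M (tmap (mu A) (lin_id A) t).
  elim/tensor_ind: t => [|x y IHx IHy|s a].
  - by rewrite !linear0 cmp0f.
  - by rewrite !linearD cmpDl IHx IHy.
  rewrite pow_ev3lE tmapE -cmpA pow_ev_nat cmpA pow_mu_ev.
  by rewrite pow_ev2_tmul.
have R t : pow_ev3 H A A A M t ∘ pow_mu (H A M) =
    pow_ev2 H A A M (tmap (lin_id A) (mu A) t).
  elim/tensor_ind: t => [|x y IHx IHy|a s].
  - by rewrite !linear0 cmp0f.
  - by rewrite !linearD cmpDl IHx IHy.
  by rewrite pow_ev3E tmapE -cmpA pow_mu_ev pow_ev2_tmul.
apply: pow_ext3 => t; rewrite [LHS]cmpA R pow_mu_ev.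
by rewrite [RHS]cmpA -pow_ev3_assocV L pow_mu_ev mu_assoc tassocVK.
Qed.

Lemma pow_mu_unit M : pow_eta (H A M) ∘ pow_mu M = idc (H A M).
Proof.
apply: pow_ext => a; rewrite pow_eta_ev cmpA -pow_ev2_tmul pow_mu_ev.
have := mu_unitr (tmul a (1 : k^o)).
by rewrite tmapE tunrE scale1r => ->; rewrite cmpf1.
Qed.

Lemma pow_psi_eps M : pow_psi M ∘ pow_eps (H A M) = fmor (H A) (pow_eps M).
Proof.
apply: pow_ext2 => t; rewrite [LHS]cmpA pow_psi_ev.
have -> : pow_ev2 H A C M (p t) ∘ pow_eps (H A M) =
    pow_ev H M (tunr (tmap (lin_id A) (eps C) (p t))).
  elim/tensor_ind: (p t) => [|x y IHx IHy|a c].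
  - by rewrite !linear0 cmp0f pow_ev0.
  - by rewrite !linearD cmpDl IHx IHy pow_evD.
  rewrite tmapE tunrE pow_ev2_tmul -cmpA pow_eps_ev pow_evZ cmpZr cmpf1.
  by [].
rewrite psi_eps.
elim/tensor_ind: t => [|x y IHx IHy|c a].
- by rewrite !linear0 cmp0f pow_ev0.
- by rewrite !linearD cmpDl -IHx -IHy pow_evD.
rewrite tmapE tunlE pow_ev2_tmul -cmpA pow_ev_nat cmpA pow_eps_ev cmpZl cmp1f pow_evZ.
by [].
Qed.

Lemma pow_psi_Delta M : pow_psi M ∘ pow_Delta (H A M) =
  fmor (H A) (pow_Delta M) ∘ pow_psi (H C M) ∘ fmor (H C) (pow_psi M).
Proof.
have E1 t : pow_ev2 H A C M t ∘ pow_Delta (H A M) =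
    pow_ev3 H A C C M (tmap (lin_id A) (Delta C) t).
  elim/tensor_ind: t => [|x y IHx IHy|a c]; first by rewrite !linear0 cmp0f.
    by rewrite !linearD cmpDl IHx IHy.
  by rewrite tmapE pow_ev3E pow_ev2_tmul -cmpA pow_Delta_ev.
have E2 t : pow_ev2 H C A M t ∘ fmor (H A) (pow_Delta M) =
    pow_ev3l H C C A M (tmap (Delta C) (lin_id A) t).
  elim/tensor_ind: t => [|x y IHx IHy|c a]; first by rewrite !linear0 cmp0f.
    by rewrite !linearD cmpDl IHx IHy.
  by rewrite tmapE pow_ev3lE pow_ev2_tmul -cmpA pow_ev_nat cmpA pow_Delta_ev.
have E3 t : pow_ev3 H C C A M t ∘ pow_psi (H C M) =
    pow_ev3 H C A C M (tmap (lin_id C) p t).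
  elim/tensor_ind: t => [|x y IHx IHy|c s]; first by rewrite !linear0 cmp0f.
    by rewrite !linearD cmpDl IHx IHy.
  by rewrite tmapE !pow_ev3E -cmpA pow_psi_ev.
have E4 t : pow_ev3l H C A C M t ∘ fmor (H C) (pow_psi M) =
    pow_ev3l H A C C M (tmap p (lin_id C) t).
  elim/tensor_ind: t => [|x y IHx IHy|s c]; first by rewrite !linear0 cmp0f.
    by rewrite !linearD cmpDl IHx IHy.
  by rewrite tmapE !pow_ev3lE -cmpA pow_ev_nat cmpA pow_psi_ev.
apply: pow_ext2 => t.
rewrite [LHS]cmpA pow_psi_ev E1 psi_Delta pow_ev3_assoc.
rewrite [RHS]cmpA [in RHS]cmpA E2 -[in RHS]pow_ev3_assoc E3.
by rewrite -pow_ev3_assocV E4.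
Qed.

Lemma pow_psi_mu M : pow_mu (H C M) ∘ pow_psi M =
  fmor (H A) (pow_psi M) ∘ pow_psi (H A M) ∘ fmor (H C) (pow_mu M).
Proof.
have E1 t : pow_ev3 H C A A M t ∘ pow_mu (H C M) =
    pow_ev2 H C A M (tmap (lin_id C) (mu A) t).
  elim/tensor_ind: t => [|x y IHx IHy|c s]; first by rewrite !linear0 cmp0f.
    by rewrite !linearD cmpDl IHx IHy.
  by rewrite pow_ev3E tmapE pow_ev2_tmul -cmpA pow_mu_ev.
have E2 t : pow_ev3l H C A A M t ∘ fmor (H A) (pow_psi M) =
    pow_ev3l H A C A M (tmap p (lin_id A) t).
  elim/tensor_ind: t => [|x y IHx IHy|s a]; first by rewrite !linear0 cmp0f.
    by rewrite !linearD cmpDl IHx IHy.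
  by rewrite tmapE !pow_ev3lE -cmpA pow_ev_nat cmpA pow_psi_ev.
have E3 t : pow_ev3 H A C A M t ∘ pow_psi (H A M) =
    pow_ev3 H A A C M (tmap (lin_id A) p t).
  elim/tensor_ind: t => [|x y IHx IHy|a s]; first by rewrite !linear0 cmp0f.
    by rewrite !linearD cmpDl IHx IHy.
  by rewrite tmapE !pow_ev3E -cmpA pow_psi_ev.
have E4 t : pow_ev3l H A A C M t ∘ fmor (H C) (pow_mu M) =
    pow_ev2 H A C M (tmap (mu A) (lin_id C) t).
  elim/tensor_ind: t => [|x y IHx IHy|s c]; first by rewrite !linear0 cmp0f.
    by rewrite !linearD cmpDl IHx IHy.
  by rewrite pow_ev3lE tmapE pow_ev2_tmul -cmpA pow_ev_nat cmpA pow_mu_ev.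
apply: pow_ext3 => t.
rewrite [LHS]cmpA E1 pow_psi_ev psi_mu [RHS]cmpA [in RHS]cmpA.
by rewrite -pow_ev3_assocV E2 -pow_ev3_assoc E3 -pow_ev3_assocV E4.
Qed.

End StructureMaps.

Record ksubspace (k : fieldType) (V : lmodType k) := KSubspace {
  sub_pred :> V -> Prop;
  sub_pred0 : sub_pred 0;
  sub_predP : forall a u v, sub_pred u -> sub_pred v -> sub_pred (a *: u + v) }.

Record sub_lmod (k : fieldType) (V : lmodType k) (P : ksubspace V) := SubLmod {
  sub_val :> V;
  sub_valP : P sub_val }.

Section SubLmod.
Context (k : fieldType) (V : lmodType k) (P : ksubspace V).
Implicit Types x y z : sub_lmod P.

Lemma sub_ext x y : sub_val x = sub_val y -> x = y.
Proof.
case: x y => [x xP] [y yP] /= xy; subst y.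
by rewrite (Prop_irrelevance xP yP).
Qed.

HB.instance Definition _ := gen_eqMixin (sub_lmod P).
HB.instance Definition _ := gen_choiceMixin (sub_lmod P).

Definition sub_zero : sub_lmod P := SubLmod (sub_pred0 P).
Definition sub_lin a x y : sub_lmod P :=
  SubLmod (sub_predP a (sub_valP x) (sub_valP y)).
Definition sub_add x y := sub_lin 1 x y.
Definition sub_scale a x := sub_lin a x sub_zero.
Definition sub_opp x := sub_scale (-1) x.

Fact sub_addA : associative sub_add.
Proof. by move=> x y z; apply: sub_ext; rewrite /= !scale1r addrA. Qed.
Fact sub_addC : commutative sub_add.
Proof. by move=> x y; apply: sub_ext; rewrite /= !scale1r addrC. Qed.
Fact sub_add0 : left_id sub_zero sub_add.
Proof. by move=> x; apply: sub_ext; rewrite /= scale1r add0r. Qed.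
Fact sub_addN : left_inverse sub_zero sub_opp sub_add.
Proof.
by move=> x; apply: sub_ext; rewrite /= scale1r addr0 scaleN1r addNr.
Qed.
HB.instance Definition _ := GRing.isZmodule.Build (sub_lmod P)
  sub_addA sub_addC sub_add0 sub_addN.

Fact sub_scaleA a b x : sub_scale a (sub_scale b x) = sub_scale (a * b) x.
Proof. by apply: sub_ext; rewrite /= !addr0 scalerA. Qed.
Fact sub_scale1 : left_id 1 sub_scale.
Proof. by move=> x; apply: sub_ext; rewrite /= addr0 scale1r. Qed.
Fact sub_scaleDr : right_distributive sub_scale +%R.
Proof.
by move=> a x y; apply: sub_ext; rewrite /= !addr0 !scale1r scalerDr.
Qed.
Fact sub_scaleDl x : {morph sub_scale^~ x : a b / a + b}.
Proof.
by move=> a b; apply: sub_ext; rewrite /= !addr0 scale1r scalerDl.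
Qed.
HB.instance Definition _ := GRing.Zmodule_isLmodule.Build k (sub_lmod P)
  sub_scaleA sub_scale1 sub_scaleDr sub_scaleDl.

Lemma sub_val_linear : linear (@sub_val k V P).
Proof. by move=> a x y; rewrite /= addr0 scale1r. Qed.

End SubLmod.

(* Objects of S with extra structure; the morphisms are the morphisms of S in
   a k-ksubspace that contains the identities and is stable under composition. *)
Section StructuredCategory.
Context (k : fieldType) (S : lincat k) (O : Type) (u : O -> S).
Context (P : forall X Y : O, ksubspace (Mor (u X) (u Y))).
Context (P1 : forall X, P X X (idc (u X))).
Context (PM : forall (X Y Z : O) (g : Mor (u Y) (u Z)) (f : Mor (u X) (u Y)),
  P Y Z g -> P X Y f -> P X Z (g ∘ f)).

Definition structured_cat : lincat k.
Proof.
refine (@LinCat k O (fun X Y => sub_lmod (P X Y) : lmodType k)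
  (fun X => SubLmod (P1 X))
  (fun X Y Z g f => SubLmod (PM (sub_valP g) (sub_valP f))) _ _ _ _ _).
- by move=> X Y Z g a f f'; apply: sub_ext; rewrite
  -[LHS]/(sub_val g ∘ sub_val (a *: f + f')) !sub_val_linear; exact: cmp_linr.
- by move=> X Y Z f a g g'; apply: sub_ext; rewrite
  -[LHS]/(sub_val (a *: g + g') ∘ sub_val f) !sub_val_linear; exact: cmp_linl.
- by move=> *; apply: sub_ext; exact: cmpA.
- by move=> *; apply: sub_ext; exact: cmp1f.
- by move=> *; apply: sub_ext; exact: cmpf1.
Defined.

End StructuredCategory.

Section Contramodules.
Context (k : fieldType) (S : lincat k) (T : tensoring S) (H : powering T).
Context (C : coalgebra k).

Record contramodule := Contramodule {
  cobj :> S;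
  cpi : Mor (H C cobj) cobj;
  cpi_eps : cpi ∘ pow_eps H C cobj = idc cobj;
  cpi_Delta : cpi ∘ pow_Delta H C cobj = cpi ∘ fmor (H C) cpi }.

Definition contra_hom (M N : contramodule) : ksubspace (Mor M N).
Proof.
exists (fun f => f ∘ cpi M = cpi N ∘ fmor (H C) f).
  rewrite cmp0f; have := @fmor_pow_linear k S T H C M N (-1) 0 0.
  by rewrite scaler0 addr0 scaleN1r addNr => ->; rewrite cmpf0.
by move=> a f g fP gP; rewrite fmor_pow_linear cmpDl cmpZl fP gP cmpDr cmpZr.
Defined.

Fact contra_hom1 M : contra_hom M M (idc M).
Proof. by rewrite /= fmor1 cmp1f cmpf1. Qed.
Fact contra_homM (M N P : contramodule) (g : Mor N P) (f : Mor M N) :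
  contra_hom N P g -> contra_hom M N f -> contra_hom M P (g ∘ f).
Proof. by move=> /= gP fP; rewrite fmorM -cmpA fP !cmpA gP. Qed.

Definition contra_cat : lincat k := structured_cat contra_hom1 contra_homM.

End Contramodules.

Section EntwinedContramodules.
Context (k : fieldType) (S : lincat k) (T : tensoring S) (H : powering T).
Context (A : algebra k) (C : coalgebra k) (p : entwining A C).

Record entwined := Entwined {
  eobj :> contramodule H C;
  emu : Mor eobj (H A eobj);
  emu_assoc : pow_mu H A eobj ∘ emu = fmor (H A) emu ∘ emu;
  emu_unit : pow_eta H A eobj ∘ emu = idc eobj;
  emu_cpi : emu ∘ cpi eobj =
    fmor (H A) (cpi eobj) ∘ pow_psi H p eobj ∘ fmor (H C) emu }.

Definition entwined_hom (M N : entwined) : ksubspace (Mor M N).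
Proof.
exists (fun f => contra_hom M N f /\ emu N ∘ f = fmor (H A) f ∘ emu M).
  split; first exact: sub_pred0.
  rewrite cmpf0; have := @fmor_pow_linear _ _ _ H A M N (-1) 0 0.
  by rewrite scaler0 addr0 scaleN1r addNr => ->; rewrite cmp0f.
move=> a f g [fc fP] [gc gP]; split; first exact: sub_predP.
by rewrite fmor_pow_linear cmpDl cmpZl -fP -gP cmpDr cmpZr.
Defined.

Fact entwined_hom1 M : entwined_hom M M (idc M).
Proof. by split; [exact: contra_hom1 | rewrite fmor1 cmp1f cmpf1]. Qed.
Fact entwined_homM (M N P : entwined) (g : Mor N P) (f : Mor M N) :
  entwined_hom N P g -> entwined_hom M N f -> entwined_hom M P (g ∘ f).
Proof.
move=> [gc gP] [fc fP]; split; first exact: contra_homM.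
by rewrite fmorM -cmpA -fP !cmpA gP.
Qed.

Definition entwined_cat : lincat k := structured_cat entwined_hom1 entwined_homM.

Definition forget_F : functor entwined_cat (contra_cat H C).
Proof.
refine (@Functor k entwined_cat (contra_cat H C) eobj
  (fun M N f => @SubLmod k _ (contra_hom M N) (sub_val f) (sub_valP f).1) _ _);
  by move=> *; apply: sub_ext.
Defined.

Section CofreeObject.
Variable M : contramodule H C.

(* (A, M) with the structures (mu, M) and (A, pi_M) (psi, M) *)
Definition T_pi : Mor (H C (H A M)) (H A M) :=
  fmor (H A) (cpi M) ∘ pow_psi H p M.

Fact T_pi_eps : T_pi ∘ pow_eps H C (H A M) = idc (H A M).
Proof. by rewrite /T_pi -cmpA pow_psi_eps -fmorM cpi_eps fmor1. Qed.

Fact T_pi_Delta : T_pi ∘ pow_Delta H C (H A M) = T_pi ∘ fmor (H C) T_pi.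
Proof.
rewrite /T_pi -cmpA pow_psi_Delta (fmorM (H C) (fmor (H A) (cpi M))).
rewrite [RHS]cmpA -[X in _ = X ∘ _]cmpA -pow_psi_nat [X in _ = X ∘ _]cmpA.
rewrite -(fmorM (H A) (cpi M)) -cpi_Delta (fmorM (H A) (cpi M)).
by rewrite [LHS]cmpA [X in X ∘ _ = _]cmpA.
Qed.

Definition T_contra : contramodule H C := Contramodule T_pi_eps T_pi_Delta.

Fact T_mu_pi : pow_mu H A M ∘ T_pi =
  fmor (H A) T_pi ∘ pow_psi H p (H A M) ∘ fmor (H C) (pow_mu H A M).
Proof.
rewrite /T_pi cmpA -pow_mu_nat -cmpA pow_psi_mu fmorM.
by rewrite !cmpA.
Qed.

Definition T_obj : entwined :=
  @Entwined T_contra (pow_mu H A M) (pow_mu_assoc H A M) (pow_mu_unit H A M)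
    T_mu_pi.

End CofreeObject.

Fact T_hom (M N : contramodule H C) (f : Mor M N) :
  contra_hom M N f -> entwined_hom (T_obj M) (T_obj N) (fmor (H A) f).
Proof.
move=> /= fP; split; last by rewrite pow_mu_nat.
rewrite /T_pi cmpA -fmorM fP fmorM -cmpA (pow_psi_nat H p (f : Mor M N)).
exact: cmpA.
Qed.

Definition functor_T : functor (contra_cat H C) entwined_cat.
Proof.
refine (@Functor k (contra_cat H C) entwined_cat T_obj
  (fun M N f => @SubLmod k _ (entwined_hom (T_obj M) (T_obj N))
     (fmor (H A) (sub_val f)) (T_hom (sub_valP f))) _ _).
- by move=> M; apply: sub_ext; exact: fmor1.
- by move=> M N P g f; apply: sub_ext; exact: fmorM.
Defined.

Lemma mu_entwined_hom (M : entwined) : entwined_hom M (T_obj M) (emu M).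
Proof. by split; [exact: emu_cpi | exact: emu_assoc]. Qed.

Lemma eta_contra_hom (M : contramodule H C) :
  contra_hom (T_contra M) M (pow_eta H A M).
Proof.
rewrite /= pow_eta_ev /T_pi cmpA pow_ev_nat -cmpA.
have -> : pow_ev H (H C M) (eta A 1) ∘ pow_psi H p M =
    fmor (H C) (pow_ev H M (eta A 1)).
  apply: pow_ext => c; rewrite pow_ev_nat cmpA -!pow_ev2_tmul -(psi_eta p).
  by rewrite pow_psi_ev.
by [].
Qed.

(* unit mu_M : M -> (A, M), counit (eta, M) : (A, M) -> M *)
Definition forget_F_adj : adjunction forget_F functor_T.
Proof.
unshelve refine (@Adjunction k _ _ forget_F functor_T
  (@NatTrans k entwined_cat entwined_cat (idF _) (functor_T \F forget_F)
    (fun M => SubLmod (mu_entwined_hom M)) _)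
  (@NatTrans k (contra_cat H C) (contra_cat H C) (forget_F \F functor_T) (idF _)
    (fun M => SubLmod (eta_contra_hom M)) _) _ _).
- by move=> M N f; apply: sub_ext; rewrite /= (sub_valP f).2.
- by move=> M N f; apply: sub_ext; rewrite /= !pow_eta_ev pow_ev_nat.
- by move=> M; apply: sub_ext; exact: emu_unit.
- move=> M; apply: sub_ext; rewrite /= pow_eta_ev.
  apply: pow_ext => a; rewrite cmpA pow_ev_nat -pow_ev2_tmul pow_mu_ev cmpf1.
  by have := mu_unitl (tmul (1 : k^o) a); rewrite tmapE tunlE scale1r => ->.
Defined.

End EntwinedContramodules.

(* Main.v *)
(** A natural transformation between functors on contramodules is determined by
    its values on free objects. A contramodule M is covered by the free one
    (C, M) through pi_M, which (eps, M) splits in S; so θ : id -> FT corresponds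
    to σ_M = θ_(C,M) (eps, M), with inverse θ_M = (A, pi_M) σ_M.
    For an A-module object N, (C, N) carries the free entwined structure with
    action (psi, N) (C, mu_N), and an entwined M is moreover embedded by
    (C, mu_M) : (C, M) -> (C, (A, M)), which (C, (eta, M)) splits. So
    θ : TF -> id corresponds to
    ρ_M = (C, (eta, M)) θ_(C,(A,M)) (A, (eps, (A, M))), with inverse
    θ_M = pi_M ρ_M (A, mu_M).
    Separability is Rafael's criterion: a right (left) adjoint is separable iff
    the counit (unit) has a natural section (retraction). *)
Require Import Defs.
From mathcomp Require Import all_boot all_algebra all_classical.

Set Implicit Arguments.
Unset Strict Implicit.
Unset Printing Implicit Defensive.

Import GRing.Theory.
Local Open Scope ring_scope.

Lemma cmp_rewr (k : fieldType) (S : lincat k) (X Y Z W : S) (h : Mor Z W)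
    (g : Mor Y Z) (f : Mor X Y) e :
  g ∘ f = e -> h ∘ g ∘ f = h ∘ e.
Proof. by move=> <-; rewrite cmpA. Qed.

Lemma fmor_rewr (k : fieldType) (C D : lincat k) (F : functor C D) (X Y Z : C)
    (g : Mor Y Z) (f : Mor X Y) e :
  g ∘ f = e -> fmor F g ∘ fmor F f = fmor F e.
Proof. by move=> <-; rewrite fmorM. Qed.

(* Syntactic matching: [rewrite !cmpA] and [rewrite !fmorM] would unfold the
   pow_* maps, which are composites. *)
Ltac cmp_norm := repeat match goal with
  |- context [cmp ?h (cmp ?g ?f)] => rewrite (cmpA h g f) end.
Ltac fmor_norm := repeat match goal with
  |- context [@fmor _ _ _ ?F _ _ (cmp ?g ?f)] => rewrite (fmorM F g f) end.
Ltac cmp_rw E := cmp_norm; first [rewrite E | rewrite (cmp_rewr _ E)]; cmp_norm.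
Ltac fmor_rw F E := cmp_rw (fmor_rewr F E); fmor_norm; cmp_norm.

Section Rafael.
Context (k : fieldType) (C D : lincat k) (L : functor C D) (R : functor D C).
Context (a : adjunction L R).

Lemma separable_right_adjoint :
  separable_functor R <->
  exists θ : nat_trans (idF D) (L \F R),
    forall Y : D, adj_counit a Y ∘ θ Y = idc Y.
Proof.
split=> [[P [P_nat P_fmor]]|[θ θK]].
  have θP (X Y : D) (f : Mor X Y) : fmor (L \F R) f ∘ P X (L (R X)) (adj_unit a (R X)) =
      P Y (L (R Y)) (adj_unit a (R Y)) ∘ fmor (idF D) f.
    have /= := P_nat _ _ _ _ (idc X) (fmor L (fmor R f)) (adj_unit a (R X)).
    rewrite fmor1 !cmpf1 => <-.
    have /= := P_nat _ _ _ _ f (idc _) (adj_unit a (R Y)).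
    rewrite fmor1 !cmp1f => <-.
    congr (P _ _ _); exact: (ntP (adj_unit a) (fmor R f)).
  exists (@NatTrans _ _ _ (idF D) (L \F R) _ θP) => Y /=.
  have := P_nat _ _ _ _ (idc Y) (adj_counit a Y) (adj_unit a (R Y)).
  rewrite fmor1 !cmpf1 => <-.
  by rewrite adj_R -fmor1 P_fmor.
exists (fun X Y h => adj_counit a Y ∘ fmor L h ∘ θ X); split.
  move=> X Y X' Y' u v h; rewrite !fmorM !cmpA.
  have := ntP (adj_counit a) v => /= ->.
  by have := ntP θ u => /= E; rewrite (cmp_rewr _ E) !cmpA.
move=> X Y f; rewrite (cmp_rewr _ (ntP θ f)) /= cmpA θK.
exact: cmp1f.
Qed.

Lemma separable_left_adjoint :
  separable_functor L <->
  exists θ : nat_trans (R \F L) (idF C),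
    forall X : C, θ X ∘ adj_unit a X = idc X.
Proof.
split=> [[P [P_nat P_fmor]]|[θ θK]].
  have θP (X Y : C) (f : Mor X Y) :
      fmor (idF C) f ∘ P (R (L X)) X (adj_counit a (L X)) =
      P (R (L Y)) Y (adj_counit a (L Y)) ∘ fmor (R \F L) f.
    have /= := P_nat _ _ _ _ (idc _) f (adj_counit a (L X)).
    rewrite fmor1 !cmpf1 => <-.
    have /= := P_nat _ _ _ _ (fmor R (fmor L f)) (idc _) (adj_counit a (L Y)).
    rewrite fmor1 !cmp1f => <-.
    congr (P _ _ _); exact: (ntP (adj_counit a) (fmor L f)).
  exists (@NatTrans _ _ _ (R \F L) (idF C) _ θP) => X /=.
  have := P_nat _ _ _ _ (adj_unit a X) (idc X) (adj_counit a (L X)).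
  rewrite fmor1 !cmp1f => <-.
  by rewrite adj_L -fmor1 P_fmor.
exists (fun X Y h => θ Y ∘ fmor R h ∘ adj_unit a X); split.
  move=> X Y X' Y' u v h; rewrite !fmorM !cmpA.
  have := ntP θ v => /= ->.
  by have := ntP (adj_unit a) u => /= E; rewrite (cmp_rewr _ E) !cmpA.
move=> X Y f; rewrite (cmp_rewr _ (ntP (adj_unit a) f)) /= cmpA θK.
exact: cmp1f.
Qed.

End Rafael.

Section StructureMaps.
Context (k : fieldType) (S : lincat k) (T : tensoring S) (H : powering T).
Context (A : algebra k) (C : coalgebra k) (p : entwining A C).
Implicit Types M N : S.

Lemma pow_eta_nat N M (f : Mor N M) :
  f ∘ pow_eta H A N = pow_eta H A M ∘ fmor (H A) f.
Proof. by rewrite !pow_eta_ev pow_ev_nat. Qed.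

Lemma pow_eps_nat N M (f : Mor N M) :
  fmor (H C) f ∘ pow_eps H C N = pow_eps H C M ∘ f.
Proof.
apply: pow_ext => c.
rewrite [LHS]cmpA pow_ev_nat -cmpA pow_eps_ev [RHS]cmpA pow_eps_ev.
by rewrite cmpZr cmpZl cmp1f cmpf1.
Qed.

Lemma pow_Delta_nat N M (f : Mor N M) :
  fmor (H C) f ∘ pow_Delta H C N = pow_Delta H C M ∘ fmor (H C) (fmor (H C) f).
Proof.
apply: pow_ext => c.
by rewrite [LHS]cmpA pow_ev_nat -cmpA pow_Delta_ev [RHS]cmpA pow_Delta_ev pow_ev2_nat.
Qed.

Lemma pow_mu_unitr M : fmor (H A) (pow_eta H A M) ∘ pow_mu H A M = idc (H A M).
Proof.
rewrite pow_eta_ev; apply: pow_ext => a.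
rewrite cmpA pow_ev_nat -pow_ev2_tmul pow_mu_ev cmpf1.
by have := mu_unitl (tmul (1 : k^o) a); rewrite tmapE tunlE scale1r => ->.
Qed.

Lemma pow_psi_eta M :
  pow_eta H A (H C M) ∘ pow_psi H p M = fmor (H C) (pow_eta H A M).
Proof.
rewrite !pow_eta_ev; apply: pow_ext => c.
by rewrite pow_ev_nat cmpA -!pow_ev2_tmul -(psi_eta p) pow_psi_ev.
Qed.

Lemma pow_Delta_eps M : pow_Delta H C M ∘ pow_eps H C (H C M) = idc (H C M).
Proof.
apply: pow_ext => c; rewrite cmpA pow_Delta_ev cmpf1.
rewrite -[c in RHS]Delta_counitr.
elim/tensor_ind: (Delta C c) => [|x y IHx IHy|c1 c2].
- by rewrite !linear0 cmp0f pow_ev0.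
- by rewrite !linearD cmpDl IHx IHy pow_evD.
by rewrite tmapE tunrE pow_ev2_tmul -cmpA pow_eps_ev pow_evZ cmpZr cmpf1.
Qed.

Lemma pow_Delta_epsr M :
  pow_Delta H C M ∘ fmor (H C) (pow_eps H C M) = idc (H C M).
Proof.
apply: pow_ext => c; rewrite cmpA pow_Delta_ev cmpf1.
rewrite -[c in RHS]Delta_counitl.
elim/tensor_ind: (Delta C c) => [|x y IHx IHy|c1 c2].
- by rewrite !linear0 cmp0f pow_ev0.
- by rewrite !linearD cmpDl IHx IHy pow_evD.
rewrite tmapE tunlE pow_ev2_tmul -cmpA pow_ev_nat cmpA pow_eps_ev pow_evZ.
by rewrite cmpZl cmp1f.
Qed.

Lemma pow_Delta_assoc M :
  pow_Delta H C M ∘ pow_Delta H C (H C M) =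
  pow_Delta H C M ∘ fmor (H C) (pow_Delta H C M).
Proof.
have R t : pow_ev2 H C C M t ∘ pow_Delta H C (H C M) =
    pow_ev3 H C C C M (tmap (lin_id C) (Delta C) t).
  elim/tensor_ind: t => [|x y IHx IHy|c c']; first by rewrite !linear0 cmp0f.
    by rewrite !linearD cmpDl IHx IHy.
  by rewrite tmapE pow_ev3E pow_ev2_tmul -cmpA pow_Delta_ev.
have L t : pow_ev2 H C C M t ∘ fmor (H C) (pow_Delta H C M) =
    pow_ev3l H C C C M (tmap (Delta C) (lin_id C) t).
  elim/tensor_ind: t => [|x y IHx IHy|c c']; first by rewrite !linear0 cmp0f.
    by rewrite !linearD cmpDl IHx IHy.
  by rewrite tmapE pow_ev3lE pow_ev2_tmul -cmpA pow_ev_nat cmpA pow_Delta_ev.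
apply: pow_ext => c.
by cmp_norm; rewrite pow_Delta_ev R L -Delta_coassoc pow_ev3_assoc.
Qed.

Definition free_contra M : contramodule H C :=
  Contramodule (pow_Delta_eps M) (pow_Delta_assoc M).

Section PartA.
Implicit Types (σ : nat_trans (idF S) (H A \F H C))
  (θ : nat_trans (idF (contra_cat H C)) (forget_F H p \F functor_T H p)).

Definition sigma_compat σ : Prop := forall M : S,
  fmor (H A) (pow_Delta H C M) ∘ pow_psi H p (H C M) ∘ fmor (H C) (σ M)
  = fmor (H A) (pow_Delta H C M) ∘ σ (H C M).

Lemma contra_nat θ (M N : contramodule H C) (f : Mor M N) :
  contra_hom M N f -> fmor (H A) f ∘ sub_val (θ M) = sub_val (θ N) ∘ f.
Proof.
by move=> fP; have := congr1 (@sub_val _ _ _) (ntP θ (SubLmod fP)).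
Qed.

Lemma contra_ntP θ (M : contramodule H C) :
  sub_val (θ M) ∘ cpi M =
  fmor (H A) (cpi M) ∘ pow_psi H p M ∘ fmor (H C) (sub_val (θ M)).
Proof. exact: (sub_valP (θ M)). Qed.

Lemma free_contra_map (M N : S) (f : Mor M N) :
  contra_hom (free_contra M) (free_contra N) (fmor (H C) f).
Proof. exact: pow_Delta_nat. Qed.

Lemma cpi_contra_hom (M : contramodule H C) :
  contra_hom (free_contra M) M (cpi M).
Proof. exact: cpi_Delta. Qed.

Definition sigma_of θ : nat_trans (idF S) (H A \F H C).
Proof.
refine (@NatTrans _ _ _ (idF S) (H A \F H C)
  (fun M => sub_val (θ (free_contra M)) ∘ pow_eps H C M) _) => M N f.
rewrite -[fmor (_ \F _) f]/(fmor (H A) (fmor (H C) f)).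
rewrite -[fmor (idF S) f]/f.
cmp_rw (contra_nat θ (free_contra_map f)).
by cmp_rw (pow_eps_nat f).
Defined.

Lemma sigma_ofE θ (M : contramodule H C) :
  sub_val (θ M) = fmor (H A) (cpi M) ∘ sigma_of θ M.
Proof.
rewrite -[sigma_of θ M]/(sub_val (θ (free_contra M)) ∘ pow_eps H C M).
cmp_rw (contra_nat θ (cpi_contra_hom M)).
by cmp_rw (cpi_eps M); rewrite cmpf1.
Qed.

Lemma sigma_ofP θ : sigma_compat (sigma_of θ).
Proof.
move=> M.
rewrite -[sigma_of θ M]/(sub_val (θ (free_contra M)) ∘ pow_eps H C M).
rewrite -[sigma_of θ (H C M)]/
  (sub_val (θ (free_contra (H C M))) ∘ pow_eps H C (H C M)).
have /= E := contra_ntP θ (free_contra M).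
rewrite fmorM; cmp_rw (esym E).
cmp_rw (pow_Delta_epsr M).
have /= E' := contra_nat θ (cpi_contra_hom (free_contra M)).
cmp_rw E'.
by cmp_rw (pow_Delta_eps M).
Qed.

Fact contra_of_hom σ (M : contramodule H C) : sigma_compat σ ->
  contra_hom M (T_contra p M) (fmor (H A) (cpi M) ∘ σ M).
Proof.
move=> h; rewrite /= /T_pi.
have /= E := ntP σ (cpi M).
cmp_rw (esym E).
rewrite -fmorM -cpi_Delta fmorM.
cmp_rw (esym (h M)).
rewrite -fmorM cpi_Delta fmorM [in RHS]fmorM.
by cmp_rw (pow_psi_nat H p (cpi M)).
Qed.

Fact contra_of_nat σ (M N : contramodule H C) (f : Mor M N) :
  contra_hom M N f ->
  fmor (H A) f ∘ (fmor (H A) (cpi M) ∘ σ M) = fmor (H A) (cpi N) ∘ σ N ∘ f.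
Proof.
move=> /= fP; have /= E := ntP σ f.
by cmp_norm; rewrite -fmorM fP fmorM; cmp_rw E.
Qed.

Definition contra_of σ (h : sigma_compat σ) :
  nat_trans (idF (contra_cat H C)) (forget_F H p \F functor_T H p).
Proof.
refine (@NatTrans _ (contra_cat H C) (contra_cat H C) (idF _)
  (forget_F H p \F functor_T H p)
  (fun M : contramodule H C => SubLmod (contra_of_hom M h)) _) => M N f.
by apply: sub_ext; exact: contra_of_nat (sub_valP f).
Defined.

Lemma contra_ofK σ (h : sigma_compat σ) : sigma_of (contra_of h) = σ.
Proof.
apply: nat_ext => M.
have -> : sigma_of (contra_of h) M =
  fmor (H A) (pow_Delta H C M) ∘ σ (H C M) ∘ pow_eps H C M by [].
have /= E := ntP σ (pow_eps H C M).
cmp_rw (esym E).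
by rewrite -fmorM pow_Delta_epsr fmor1 cmp1f.
Qed.

Lemma sigma_iso :
  nat_iso_sub (idF (contra_cat H C)) (forget_F H p \F functor_T H p) sigma_compat.
Proof.
exists sigma_of; split.
- move=> a s t; apply: nat_ext => M.
  rewrite -[sigma_of _ M]/(sub_val (a *: s (free_contra M) + t (free_contra M)) ∘ _).
  by rewrite sub_val_linear cmpDl cmpZl.
- move=> s t st; apply: nat_ext => M; apply: sub_ext.
  by rewrite !sigma_ofE st.
by move=> σ; split=> [h|[θ <-]]; [exists (contra_of h); exact: contra_ofK
  | exact: sigma_ofP].
Qed.

Lemma sigma_separable :
  separable_functor (functor_T H p) <->
  exists2 σ, sigma_compat σ &
    forall M : S, pow_eta H A (H C M) ∘ σ M = pow_eps H C M.
Proof.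
rewrite (separable_right_adjoint (forget_F_adj H p)); split.
  move=> [θ θK]; exists (sigma_of θ); first exact: sigma_ofP.
  move=> M.
  rewrite -[sigma_of θ M]/(sub_val (θ (free_contra M)) ∘ pow_eps H C M).
  have /= E := congr1 (@sub_val _ _ _) (θK (free_contra M)).
  by cmp_rw E; rewrite cmp1f.
move=> [σ h hK]; exists (contra_of h) => M; apply: sub_ext => /=.
cmp_rw (esym (pow_eta_nat (cpi M))); cmp_rw (hK M).
exact: cpi_eps.
Qed.

End PartA.

Record module_object := ModuleObject {
  mobj :> S;
  mmu : Mor mobj (H A mobj);
  mmu_assoc : pow_mu H A mobj ∘ mmu = fmor (H A) mmu ∘ mmu;
  mmu_unit : pow_eta H A mobj ∘ mmu = idc mobj }.

Definition cofree_module M : module_object :=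
  ModuleObject (pow_mu_assoc H A M) (pow_mu_unit H A M).

Definition entwined_module (M : entwined H p) : module_object :=
  ModuleObject (emu_assoc M) (emu_unit M).

Section FreeEntwined.
Variable N : module_object.

Definition free_mu : Mor (H C N) (H A (H C N)) :=
  pow_psi H p N ∘ fmor (H C) (mmu N).

Fact free_mu_assoc : pow_mu H A (H C N) ∘ free_mu = fmor (H A) free_mu ∘ free_mu.
Proof.
rewrite /free_mu fmorM; cmp_rw (pow_psi_mu H p N).
fmor_rw (H C) (mmu_assoc N).
by cmp_rw (esym (pow_psi_nat H p (mmu N))).
Qed.

Fact free_mu_unit : pow_eta H A (H C N) ∘ free_mu = idc (H C N).
Proof.
by rewrite /free_mu; cmp_rw (pow_psi_eta N); rewrite -fmorM mmu_unit fmor1.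
Qed.

Fact free_mu_pi : free_mu ∘ cpi (free_contra N) =
  fmor (H A) (cpi (free_contra N)) ∘ pow_psi H p (free_contra N) ∘
  fmor (H C) free_mu.
Proof.
rewrite /= /free_mu; cmp_rw (pow_Delta_nat (mmu N)).
by cmp_rw (pow_psi_Delta H p N); rewrite fmorM; cmp_norm.
Qed.

Definition free_entwined : entwined H p :=
  @Entwined _ _ _ _ _ _ _ (free_contra N) free_mu free_mu_assoc free_mu_unit
    free_mu_pi.

End FreeEntwined.

Lemma free_entwined_map (M N : module_object) (f : Mor M N) :
  mmu N ∘ f = fmor (H A) f ∘ mmu M ->
  entwined_hom (free_entwined M) (free_entwined N) (fmor (H C) f).
Proof.
move=> fP; split; first exact: pow_Delta_nat.
rewrite /= /free_mu; cmp_rw (pow_psi_nat H p f).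
by fmor_rw (H C) fP.
Qed.

Lemma cpi_entwined_hom (M : entwined H p) :
  entwined_hom (free_entwined (entwined_module M)) M (cpi M).
Proof.
split; first exact: cpi_Delta.
by rewrite /= /free_mu; cmp_norm; exact: emu_cpi.
Qed.

Lemma free_mu_eps M :
  free_mu (cofree_module M) ∘ pow_eps H C (H A M) =
  fmor (H A) (pow_eps H C (H A M)) ∘ pow_mu H A M.
Proof.
rewrite /free_mu /=; cmp_rw (pow_eps_nat (pow_mu H A M)).
by cmp_rw (pow_psi_eps H p (H A M)).
Qed.

Section PartB.
Implicit Types (ρ : nat_trans (H A \F H A) (H C))
  (θ : nat_trans (functor_T H p \F forget_F H p) (idF (entwined_cat H p))).

Definition rho_compat ρ : Prop := forall M : S,
    fmor (H A) (ρ M) ∘ pow_mu H A (H A M)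
    = pow_psi H p M ∘ ρ (H A M) ∘ fmor (H A) (pow_mu H A M) /\
    pow_Delta H C M ∘ fmor (H C) (ρ M)
    = pow_Delta H C M ∘ ρ (H C M) ∘ fmor (H A) (pow_psi H p M)
      ∘ pow_psi H p (H A M).

Lemma entwined_nat θ (M N : entwined H p) (f : Mor M N) :
  entwined_hom M N f -> f ∘ sub_val (θ M) = sub_val (θ N) ∘ fmor (H A) f.
Proof.
by move=> fP; have := congr1 (@sub_val _ _ _) (ntP θ (SubLmod fP)).
Qed.

Lemma entwined_ntPc θ (M : entwined H p) :
  sub_val (θ M) ∘ (fmor (H A) (cpi M) ∘ pow_psi H p M) =
  cpi M ∘ fmor (H C) (sub_val (θ M)).
Proof. exact: (sub_valP (θ M)).1. Qed.

Lemma entwined_ntPm θ (M : entwined H p) :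
  emu M ∘ sub_val (θ M) = fmor (H A) (sub_val (θ M)) ∘ pow_mu H A M.
Proof. exact: (sub_valP (θ M)).2. Qed.

Definition at_free θ M : Mor (H A (H C (H A M))) (H C (H A M)) :=
  sub_val (θ (free_entwined (cofree_module M))).

Lemma at_free_map θ (M N : S) (f : Mor (H A M) (H A N)) :
  pow_mu H A N ∘ f = fmor (H A) f ∘ pow_mu H A M ->
  fmor (H C) f ∘ at_free θ M = at_free θ N ∘ fmor (H A) (fmor (H C) f).
Proof.
exact: (fun fP => entwined_nat θ
  (@free_entwined_map (cofree_module M) (cofree_module N) f fP)).
Qed.

Definition rho_map θ M : Mor (H A (H A M)) (H C M) :=
  fmor (H C) (pow_eta H A M) ∘ at_free θ M ∘ fmor (H A) (pow_eps H C (H A M)).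

Fact rho_map_nat θ (M N : S) (f : Mor M N) :
  fmor (H C) f ∘ rho_map θ M = rho_map θ N ∘ fmor (H A) (fmor (H A) f).
Proof.
rewrite /rho_map; fmor_rw (H C) (pow_eta_nat f).
cmp_rw (at_free_map θ (esym (pow_mu_nat H A f))).
by fmor_rw (H A) (pow_eps_nat (fmor (H A) f)).
Qed.

Definition rho_of θ : nat_trans (H A \F H A) (H C) :=
  @NatTrans _ _ _ (H A \F H A) (H C) (rho_map θ) (rho_map_nat θ).

Lemma rho_of_ntc θ M : rho_of θ M = rho_map θ M. Proof. by []. Qed.

Lemma rho_ofE θ (M : entwined H p) :
  sub_val (θ M) = cpi M ∘ rho_of θ M ∘ fmor (H A) (emu M).
Proof.
rewrite rho_of_ntc /rho_map.
have E := entwined_nat θ (@free_entwined_map (entwined_module M)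
  (cofree_module M) (emu M) (emu_assoc M)).
fmor_rw (H A) (esym (pow_eps_nat (emu M))).
cmp_rw (esym E).
fmor_rw (H C) (emu_unit M); rewrite fmor1 cmpf1.
cmp_rw (entwined_nat θ (cpi_entwined_hom M)).
by fmor_rw (H A) (cpi_eps M); rewrite fmor1 cmpf1.
Qed.

Lemma rho_ofP θ : rho_compat (rho_of θ).
Proof.
move=> M; rewrite !rho_of_ntc; split.
  transitivity (pow_psi H p M ∘ at_free θ M ∘ fmor (H A) (pow_eps H C (H A M))).
    rewrite /rho_map; fmor_norm.
    cmp_rw (pow_mu_nat H A (pow_eps H C (H A M))).
    have /= E := entwined_ntPm θ (free_entwined (cofree_module M)).
    cmp_rw (esym E); rewrite /free_mu /=.
    cmp_rw (pow_psi_nat H p (pow_eta H A M)).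
    by fmor_rw (H C) (pow_mu_unitr M); rewrite fmor1 cmpf1.
  rewrite /rho_map; cmp_norm.
  fmor_rw (H A) (esym (pow_eps_nat (pow_mu H A M))).
  cmp_rw (esym (at_free_map θ (pow_mu_assoc H A M))).
  by fmor_rw (H C) (pow_mu_unit H A M); rewrite fmor1 cmpf1.
transitivity (fmor (H C) (pow_eta H A M) ∘ at_free θ M ∘ pow_psi H p (H A M)).
  rewrite /rho_map; fmor_norm.
  cmp_rw (esym (pow_Delta_nat (pow_eta H A M))).
  have /= E := entwined_ntPc θ (free_entwined (cofree_module M)).
  cmp_rw (esym E).
  cmp_rw (esym (pow_psi_nat H p (pow_eps H C (H A M)))).
  by fmor_rw (H A) (pow_Delta_epsr (H A M)); rewrite fmor1 cmpf1.
rewrite /rho_map; cmp_norm.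
fmor_rw (H A) (esym (pow_eps_nat (pow_psi H p M))).
have E := entwined_nat θ (@free_entwined_map
  (entwined_module (free_entwined (cofree_module M)))
  (cofree_module (H C M)) (pow_psi H p M)
  (etrans (pow_psi_mu H p M) (esym (cmpA _ _ _)))).
cmp_rw (esym E).
fmor_rw (H C) (pow_psi_eta M).
cmp_rw (esym (pow_Delta_nat (pow_eta H A M))).
have /= E' := entwined_nat θ (cpi_entwined_hom (free_entwined (cofree_module M))).
cmp_rw E'.
by fmor_rw (H A) (pow_Delta_eps (H A M)); rewrite fmor1 cmpf1.
Qed.

Fact entwined_of_contra ρ (M : entwined H p) : rho_compat ρ ->
  contra_hom (T_contra p M) M (cpi M ∘ ρ M ∘ fmor (H A) (emu M)).
Proof.
move=> h; rewrite /= /T_pi.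
fmor_norm; cmp_rw (esym (cpi_Delta M)); cmp_rw (h M).2.
cmp_rw (cpi_Delta M); cmp_rw (esym (pow_psi_nat H p (emu M))).
have /= E := ntP ρ (cpi M); cmp_rw E.
by fmor_rw (H A) (emu_cpi M).
Qed.

Fact entwined_of_hom ρ (M : entwined H p) : rho_compat ρ ->
  entwined_hom (T_obj p M) M (cpi M ∘ ρ M ∘ fmor (H A) (emu M)).
Proof.
move=> h; split; first exact: entwined_of_contra.
rewrite /=; fmor_norm; cmp_rw (emu_cpi M).
have /= E := ntP ρ (emu M); cmp_rw E.
fmor_rw (H A) (esym (emu_assoc M)).
cmp_rw (pow_mu_nat H A (emu M)).
by cmp_rw (h M).1.
Qed.

Fact entwined_of_nat ρ (M N : entwined H p) (f : Mor M N) :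
  entwined_hom M N f ->
  f ∘ (cpi M ∘ ρ M ∘ fmor (H A) (emu M)) =
  cpi N ∘ ρ N ∘ fmor (H A) (emu N) ∘ fmor (H A) f.
Proof.
move=> [/= fc fm]; cmp_rw fc; have /= E := ntP ρ f; cmp_rw E.
by fmor_rw (H A) (esym fm).
Qed.

Definition entwined_of ρ (h : rho_compat ρ) :
  nat_trans (functor_T H p \F forget_F H p) (idF (entwined_cat H p)).
Proof.
refine (@NatTrans _ (entwined_cat H p) (entwined_cat H p)
  (functor_T H p \F forget_F H p) (idF _)
  (fun M : entwined H p => SubLmod (entwined_of_hom M h)) _) => M N f.
by apply: sub_ext; exact: entwined_of_nat (sub_valP f).
Defined.

Lemma entwined_ofK ρ (h : rho_compat ρ) : rho_of (entwined_of h) = ρ.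
Proof.
apply: nat_ext => M.
rewrite -[LHS]/(rho_map (entwined_of h) M) /rho_map.
have -> : at_free (entwined_of h) M = pow_Delta H C (H A M) ∘ ρ (H C (H A M)) ∘
  fmor (H A) (free_mu (cofree_module M)) by [].
fmor_rw (H A) (free_mu_eps M).
have /= E := ntP ρ (pow_eps H C (H A M)); cmp_rw (esym E).
cmp_rw (pow_Delta_epsr (H A M)); rewrite cmpf1.
have /= E' := ntP ρ (pow_eta H A M); cmp_rw E'.
by fmor_rw (H A) (pow_mu_unitr M); rewrite fmor1 cmpf1.
Qed.

Lemma rho_iso :
  nat_iso_sub (functor_T H p \F forget_F H p) (idF (entwined_cat H p)) rho_compat.
Proof.
exists rho_of; split.
- move=> a s t; apply: nat_ext => M.
  rewrite rho_of_ntc /rho_map.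
  set N := free_entwined (cofree_module M).
  rewrite -[at_free (nat_lin a s t) M]/(sub_val (a *: s N + t N)).
  by rewrite sub_val_linear cmpDr cmpZr cmpDl cmpZl.
- move=> s t st; apply: nat_ext => M; apply: sub_ext.
  by rewrite !rho_ofE st.
by move=> ρ; split=> [h|[θ <-]]; [exists (entwined_of h); exact: entwined_ofK
  | exact: rho_ofP].
Qed.

Lemma rho_separable :
  separable_functor (forget_F H p) <->
  exists2 ρ, rho_compat ρ &
    forall M : S, ρ M ∘ pow_mu H A M = pow_eps H C M ∘ pow_eta H A M.
Proof.
rewrite (separable_left_adjoint (forget_F_adj H p)); split.
  move=> [θ θK]; exists (rho_of θ); first exact: rho_ofP.
  move=> M; rewrite rho_of_ntc /rho_map.
  have /= E := congr1 (@sub_val _ _ _) (θK (free_entwined (cofree_module M))).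
  rewrite -[sub_val _]/(at_free θ M) in E.
  cmp_rw (esym (free_mu_eps M)); cmp_rw E.
  by rewrite cmpf1 pow_eps_nat.
move=> [ρ h hK]; exists (entwined_of h) => M; apply: sub_ext => /=.
cmp_rw (esym (emu_assoc M)); cmp_rw (hK M).
by cmp_rw (cpi_eps M); rewrite cmp1f emu_unit.
Qed.

End PartB.

End StructureMaps.

Theorem theorem2 (k : fieldType) (k_char0 : [pchar k]%R =i pred0)
  (A : algebra k) (C : coalgebra k) (p : entwining A C)
  (S : lincat k) (T : tensoring S) (H : powering T)
  (S_grothendieck : grothendieck S) (C_exact : exact_functor (H C)) :
  let FF := forget_F H p in
  let TT := functor_T H p in
  let V1 (σ : nat_trans (idF S) (H A \F H C)) := forall M : S,
    fmor (H A) (pow_Delta H C M) ∘ pow_psi H p (H C M) ∘ fmor (H C) (σ M)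
    = fmor (H A) (pow_Delta H C M) ∘ σ (H C M) in
  let W1 (ρ : nat_trans (H A \F H A) (H C)) := forall M : S,
    fmor (H A) (ρ M) ∘ pow_mu H A (H A M)
    = pow_psi H p M ∘ ρ (H A M) ∘ fmor (H A) (pow_mu H A M) /\
    pow_Delta H C M ∘ fmor (H C) (ρ M)
    = pow_Delta H C M ∘ ρ (H C M) ∘ fmor (H A) (pow_psi H p M)
      ∘ pow_psi H p (H A M) in
  (nat_iso_sub (idF (contra_cat H C)) (FF \F TT) V1 /\
   (separable_functor TT <->
    exists2 σ, V1 σ &
      forall M : S, pow_eta H A (H C M) ∘ σ M = pow_eps H C M)) /\
  (nat_iso_sub (TT \F FF) (idF (entwined_cat H p)) W1 /\
   (separable_functor FF <->
    exists2 ρ, W1 ρ &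
      forall M : S, ρ M ∘ pow_mu H A M = pow_eps H C M ∘ pow_eta H A M)).
Proof.
by split; split; [exact: sigma_iso | exact: sigma_separable | exact: rho_iso
  | exact: rho_separable].
Qed.
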